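(* Let $\Omega$ be an infinite set and let $\mathfrak{P}(\Omega)$ denote its powerset. Then: (1) $\coprod^0_{\mathfrak{P}(\Omega)}\operatorname{Eq}\Omega$ has a $0$-lattice embedding into $\operatorname{Eq}\Omega$; (2) $\coprod_{\mathfrak{P}(\Omega)}\operatorname{Eq}\Omega$ has a lattice embedding into $\operatorname{Eq}\Omega$; (3) $\coprod^1_{\mathfrak{P}(\Omega)}(\operatorname{Eq}\Omega)^{\mathrm{op}}$ has a $1$-lattice embedding into $(\operatorname{Eq}\Omega)^{\mathrm{op}}$; (4) $\coprod_{\mathfrak{P}(\Omega)}(\operatorname{Eq}\Omega)^{\mathrm{op}}$ has a lattice embedding into $(\operatorname{Eq}\Omega)^{\mathrm{op}}$.
   Context: $\operatorname{Eq}\Omega$ denotes the lattice of all equivalence relations on $\Omega$, ordered by inclusion; $L^{\mathrm{op}}$ is the dual of a lattice $L$. For a set $I$ and a lattice $L$: $\coprod_I L$ is the coproduct (free product) of $I$ copies of $L$ in the variety of all lattices; if $L$ has a zero, $\coprod^0_I L$ is the coproduct of $I$ copies of $L$ in the category of lattices with zero and zero-preserving homomorphisms; if $L$ has a unit, $\coprod^1_I L$ is the coproduct in the category of lattices with unit and unit-preserving homomorphisms. A $0$-lattice embedding (resp. $1$-lattice embedding) is a one-to-one lattice homomorphism preserving the least (resp. greatest) element. *)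

(* Defs.v *)
From HB Require Import structures.
From mathcomp Require Import all_boot all_order.
From mathcomp Require Import boolp classical_sets cardinality.

Set Implicit Arguments.
Unset Strict Implicit.
Unset Printing Implicit Defensive.

Import Order.TTheory.
Local Open Scope order_scope.

Definition is_equivalence (T : Type) (R : T -> T -> Prop) : Prop :=
  [/\ (forall x, R x x),
      (forall x y, R x y -> R y x) &
      (forall x y z, R x y -> R y z -> R x z)].

Record equivrel (T : Type) := EqRel {
  erel :> T -> T -> Prop;
  erel_equiv : is_equivalence erel }.

Fact eqrel_display : Order.disp_t. Proof. exact: Order.Disp tt tt. Qed.

Section EqRelLattice.
Variable T : Type.

HB.instance Definition _ := gen_eqMixin (equivrel T).
HB.instance Definition _ := gen_choiceMixin (equivrel T).

Lemma eqrel_ext (R S : equivrel T) : (forall x y, R x y <-> S x y) -> R = S.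
Proof.
case: R => R HR; case: S => S HS /= H.
have E : R = S by apply: funext => x; apply: funext => y; apply: propext.
by subst S; rewrite (Prop_irrelevance HR HS).
Qed.

Definition eqrel_le (R S : equivrel T) : bool := `[< forall x y, R x y -> S x y >].

Lemma eqrel_leP (R S : equivrel T) : reflect (forall x y, R x y -> S x y) (eqrel_le R S).
Proof. exact: asboolP. Qed.

Lemma eqrel_le_refl : reflexive eqrel_le.
Proof. by move=> R; apply/eqrel_leP. Qed.

Lemma eqrel_le_anti : antisymmetric eqrel_le.
Proof.
move=> R S /andP[/eqrel_leP H1 /eqrel_leP H2]; apply: eqrel_ext => x y.
by split; [apply: H1 | apply: H2].
Qed.

Lemma eqrel_le_trans : transitive eqrel_le.
Proof.
move=> S R U /eqrel_leP H1 /eqrel_leP H2; apply/eqrel_leP => x y /H1; exact: H2.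
Qed.

HB.instance Definition _ :=
  Order.Le_isPOrder.Build eqrel_display (equivrel T)
    eqrel_le_refl eqrel_le_anti eqrel_le_trans.

Lemma eqrel_meet_equiv (R S : equivrel T) :
  is_equivalence (fun x y => R x y /\ S x y).
Proof.
case: R S => [R [R1 R2 R3]] [S [S1 S2 S3]] /=; split.
- by move=> x; split.
- by move=> x y [? ?]; split; [apply: R2 | apply: S2].
- by move=> x y z [? ?] [? ?]; split; [apply: (R3 _ y) | apply: (S3 _ y)].
Qed.

Definition eqrel_meet (R S : equivrel T) : equivrel T := EqRel (eqrel_meet_equiv R S).

Lemma eqrel_join_equiv (R S : equivrel T) :
  is_equivalence (fun x y => forall E : equivrel T,
     (forall a b, R a b -> E a b) -> (forall a b, S a b -> E a b) -> E x y).
Proof.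
split.
- by move=> x E _ _; case: (erel_equiv E) => ? _ _.
- move=> x y H E HR HS; case: (erel_equiv E) => _ Es _; exact: Es (H E HR HS).
- move=> x y z H1 H2 E HR HS; case: (erel_equiv E) => _ _ Et.
  exact: Et (H1 E HR HS) (H2 E HR HS).
Qed.

Definition eqrel_join (R S : equivrel T) : equivrel T := EqRel (eqrel_join_equiv R S).

Lemma eqrel_lexI (R S U : equivrel T) :
  (R <= eqrel_meet S U) = (R <= S) && (R <= U).
Proof.
apply/idP/andP.
- move=> /eqrel_leP H; split; apply/eqrel_leP => x y /H [].
  + by [].
  + by [].
- move=> [/eqrel_leP H1 /eqrel_leP H2]; apply/eqrel_leP => x y Hxy.
  by split; [apply: H1 | apply: H2].
Qed.

Lemma eqrel_leUx (R S U : equivrel T) :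
  (eqrel_join R S <= U) = (R <= U) && (S <= U).
Proof.
apply/idP/andP.
- move=> /eqrel_leP H; split; apply/eqrel_leP => x y Hxy; apply: H => E HR HS.
  + exact: HR.
  + exact: HS.
- move=> [/eqrel_leP H1 /eqrel_leP H2]; apply/eqrel_leP => x y Hxy.
  exact: Hxy U H1 H2.
Qed.

HB.instance Definition _ :=
  Order.POrder_isMeetSemilattice.Build eqrel_display (equivrel T) eqrel_lexI.
HB.instance Definition _ :=
  Order.POrder_isJoinSemilattice.Build eqrel_display (equivrel T) eqrel_leUx.

Lemma eqrel_id_equiv : is_equivalence (fun x y : T => x = y).
Proof. by split=> [x|x y ->|x y z -> ->]. Qed.

Definition eqrel_id : equivrel T := EqRel eqrel_id_equiv.

Lemma eqrel_full_equiv : is_equivalence (fun _ _ : T => True).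
Proof. by []. Qed.

Definition eqrel_full : equivrel T := EqRel eqrel_full_equiv.

Lemma eqrel_le0x (R : equivrel T) : eqrel_id <= R.
Proof.
apply/eqrel_leP => x y /= ->; by case: (erel_equiv R).
Qed.

Lemma eqrel_lex1 (R : equivrel T) : R <= eqrel_full.
Proof. by apply/eqrel_leP. Qed.

HB.instance Definition _ :=
  Order.hasBottom.Build eqrel_display (equivrel T) eqrel_le0x.
HB.instance Definition _ :=
  Order.hasTop.Build eqrel_display (equivrel T) eqrel_lex1.

End EqRelLattice.

Definition lattice_hom {d d'} {L : latticeType d} {M : latticeType d'}
    (f : L -> M) : Prop :=
  forall x y, f (x `&` y) = f x `&` f y /\ f (x `|` y) = f x `|` f y.

Definition lattice0_hom {d d'} {L : bLatticeType d} {M : bLatticeType d'}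
    (f : L -> M) : Prop := lattice_hom f /\ f \bot = \bot.

Definition lattice1_hom {d d'} {L : tLatticeType d} {M : tLatticeType d'}
    (f : L -> M) : Prop := lattice_hom f /\ f \top = \top.

Definition lattice_embedding {d d'} {L : latticeType d} {M : latticeType d'}
    (f : L -> M) : Prop := lattice_hom f /\ injective f.

Definition lattice0_embedding {d d'} {L : bLatticeType d} {M : bLatticeType d'}
    (f : L -> M) : Prop := lattice0_hom f /\ injective f.

Definition lattice1_embedding {d d'} {L : tLatticeType d} {M : tLatticeType d'}
    (f : L -> M) : Prop := lattice1_hom f /\ injective f.

Definition lattice_coproduct (I : Type) {d dC} (L : latticeType d)
    (C : latticeType dC) (iota : I -> L -> C) : Prop :=
  (forall i, lattice_hom (iota i)) /\
  forall dM (M : latticeType dM) (f : I -> L -> M),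
    (forall i, lattice_hom (f i)) ->
    exists! h : C -> M, lattice_hom h /\ (forall i x, h (iota i x) = f i x).

Definition lattice0_coproduct (I : Type) {d dC} (L : bLatticeType d)
    (C : bLatticeType dC) (iota : I -> L -> C) : Prop :=
  (forall i, lattice0_hom (iota i)) /\
  forall dM (M : bLatticeType dM) (f : I -> L -> M),
    (forall i, lattice0_hom (f i)) ->
    exists! h : C -> M, lattice0_hom h /\ (forall i x, h (iota i x) = f i x).

Definition lattice1_coproduct (I : Type) {d dC} (L : tLatticeType d)
    (C : tLatticeType dC) (iota : I -> L -> C) : Prop :=
  (forall i, lattice1_hom (iota i)) /\
  forall dM (M : tLatticeType dM) (f : I -> L -> M),
    (forall i, lattice1_hom (f i)) ->
    exists! h : C -> M, lattice1_hom h /\ (forall i x, h (iota i x) = f i x).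

(* Main.v *)
(* Represent the elements of a coproduct by lattice terms p, q whose constants
   lie in the factors.  For factors Eq(Omega), call a term finite if its
   constants have finite support; there are only |Omega| of these as long as the
   index set has size at most |Omega|.  Sets of finite terms that are closed in a
   suitable sense form a lattice in which joins can be computed by recursion on
   terms, following the solution of the word problem for free products (with
   upper covers).  Each factor maps to it by R |-> {s | upper cover of s <= R},
   and a compactness argument (every equivalence relation is the directed union
   of its finite restrictions) shows that an inequality between the values of p
   and q forces p <= q in the coproduct.  Jonsson's construction yields a metric
   space with distances in the finite terms such that V |-> {(x, y) | d(x, y) in V}
   is an embedding of this lattice into the equivalence relations on |Omega|
   points.  De Bruijn's trick gives 2^|Omega| factors: an index i, a subset of
   Omega, acts on the component l, a finite list in Omega, as the factor named
   by the trace of i on l, and any finite set of indices is separated by some l.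
   The plain coproduct is treated by adjoining a new zero to each factor, and the
   statements on duals are the duals of the other two. *)
Require Import Defs.
From HB Require Import structures.
From mathcomp Require Import all_boot all_order.
From mathcomp Require Import boolp classical_sets cardinality.
From mathcomp Require Import functions.
From Stdlib Require List.

Set Implicit Arguments.
Unset Strict Implicit.
Unset Printing Implicit Defensive.
Import Order.TTheory.
Local Open Scope order_scope.

(** * Infinite cardinals *)

Section Cardinality.
Local Open Scope classical_set_scope.

Definition injects (A B : Type) := exists f : A -> B, injective f.

(** Zorn's lemma gives a maximal graph of a partial injection from [A] to [B]. It is total on [A] or
    onto [B], since otherwise one more pair could be added. *)
Lemma card_comparable (T : Type) (A B : set T) :
  (exists g : T -> T, (forall x, A x -> B (g x)) /\
      (forall x y, A x -> A y -> g x = g y -> x = y)) \/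
  (exists g : T -> T, (forall x, B x -> A (g x)) /\
      (forall x y, B x -> B y -> g x = g y -> x = y)).
Proof.
pose P (G : set (T * T)) :=
  [/\ forall x y, G (x, y) -> A x /\ B y,
      forall x y y', G (x, y) -> G (x, y') -> y = y' &
      forall x x' y, G (x, y) -> G (x', y) -> x = x'].
have [F FP Ftot|G [[GAB Gf Gi] Gmax]] := @Zorn_bigcup _ P.
  have two u v : (\bigcup_(X in F) X) u -> (\bigcup_(X in F) X) v ->
      exists X, [/\ F X, X u & X v].
    move=> [X FX Xu] [Y FY Yv]; case: (Ftot X Y FX FY) => H.
      by exists Y; split=> //; apply: H.
    by exists X; split=> //; apply: H.
  split=> [x y [X FX Xxy]|x y y' /two H /H [X [FX X1 X2]]|x x' y /two H /H [X [FX X1 X2]]].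
  - by have [+ _ _] := FP X FX; apply.
  - by have [_ + _] := FP X FX; apply; eassumption.
  - by have [_ _ +] := FP X FX; apply; eassumption.
have [totA|/existsNP[a /not_implyP[Aa aG]]] :=
    pselect (forall x, A x -> exists y, G (x, y)).
  left; have /choice[g gP] : forall x, exists y, A x -> G (x, y).
    move=> x; case: (pselect (A x)) => [/totA[y]|nA]; first by exists y.
    by exists x.
  exists g; split=> [x /gP/GAB[]//|x y /gP Gx /gP Gy gxy].
  by apply: Gi Gx _; rewrite gxy.
have [totB|/existsNP[b /not_implyP[Bb bG]]] :=
    pselect (forall y, B y -> exists x, G (x, y)).
  right; have /choice[g gP] : forall y, exists x, B y -> G (x, y).
    move=> y; case: (pselect (B y)) => [/totB[x]|nB]; first by exists x.
    by exists y.
  exists g; split=> [y /gP/GAB[]//|x y /gP Gx /gP Gy gxy].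
  by apply: Gf Gx _; rewrite gxy.
exfalso; apply: (Gmax (G `|` [set (a, b)])).
  split; first by move=> x Gx; left.
  by move=> /(_ (a, b)) H; apply: aG; exists b; apply: H; right.
split=> [x y [/GAB//|[-> ->]//]|x y y'|x x' y].
- move=> [G1|[? ?]] [G2|[? ?]]; subst => //; first exact: Gf G1 G2.
  + by case: aG; exists y.
  + by case: aG; exists y'.
- move=> [G1|[? ?]] [G2|[? ?]]; subst => //; first exact: Gi G1 G2.
  + by case: bG; exists x.
  + by case: bG; exists x'.
Qed.

Lemma injects_nat (T : Type) : infinite_set [set: T] -> injects nat T.
Proof.
move=> /infiniteP/card_leP[e].
exists (fun n => val (e (SigSub (mem_set (I : [set: nat] n))))) => x y /val_inj/inj.
by rewrite !inE => /(_ I I) [].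
Qed.

(** * The square of an infinite set *)

Section Square.
Variable T : Type.

Definition edge_dom (G : set (T * T * T)) x := exists y z, G (x, y, z).

(** Graph of an injection from D x D to D, with D read off as [edge_dom G]. Being a set of triples,
    it is open to Zorn's lemma. *)
Definition pairing_graph (G : set (T * T * T)) :=
  [/\ forall x y z, G (x, y, z) -> [/\ edge_dom G x, edge_dom G y & edge_dom G z],
      forall x y, edge_dom G x -> edge_dom G y -> exists z, G (x, y, z),
      forall x y z z', G (x, y, z) -> G (x, y, z') -> z = z' &
      forall x y x' y' z, G (x, y, z) -> G (x', y', z) -> x = x' /\ y = y'].

Lemma pairing_graph_chain (F : set (set (T * T * T))) :
  (forall X, F X -> pairing_graph X) -> total_on F subset ->
  pairing_graph (\bigcup_(X in F) X).
Proof.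
move=> FP Ftot.
have two u v : (\bigcup_(X in F) X) u -> (\bigcup_(X in F) X) v ->
    exists X, [/\ F X, X u & X v].
  move=> [X FX Xu] [Y FY Yv]; case: (Ftot X Y FX FY) => H.
    by exists Y; split=> //; apply: H.
  by exists X; split=> //; apply: H.
have dom X x : F X -> edge_dom X x -> edge_dom (\bigcup_(X in F) X) x.
  by move=> FX [y [z h]]; exists y, z, X.
split.
- move=> x y z [X FX /[dup] Xxyz]; have [+ _ _ _] := FP X FX => /[apply].
  by case=> d1 d2 d3; split; apply: (dom X).
- move=> x y [x1 [x2 /two hx]] [y1 [y2 /hx [X [FX Xx Xy]]]].
  have [_ H _ _] := FP X FX.
  have [||z] := H x y; [by exists x1, x2|by exists y1, y2|].
  by exists z, X.
- by move=> x y z z' /two H /H[X [FX]]; have [_ _ + _] := FP X FX; apply.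
- by move=> x y x' y' z /two H /H[X [FX]]; have [_ _ _ +] := FP X FX; apply.
Qed.

(** Take a maximal pairing, with domain [A]. If the complement of [A] injects into [A], so does all
    of [T], and the pairing of [A] suffices. Otherwise the complement contains a copy [B] of [A],
    and the pairing extends to the union of [A] and [B], against maximality. *)
Theorem infinite_square : infinite_set [set: T] -> injects (T * T) T.
Proof.
move=> /injects_nat[e einj].
pose G0 : set (T * T * T) :=
  [set u | exists m n, u = (e m, e n, e (pickle (m, n)))].
have G0P : pairing_graph G0.
  have dom n : edge_dom G0 (e n) by exists (e n), (e (pickle (n, n))), n, n.
  split.
  - by move=> x y z [m [n [-> -> ->]]]; split.
  - move=> x y [? [? [m [? [-> _ _]]]]] [? [? [n [? [-> _ _]]]]].
    by exists (e (pickle (m, n))), m, n.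
  - move=> x y z z' [m [n [-> -> ->]]] [m' [n' [/einj-> /einj-> ->]]].
    by [].
  - move=> x y x' y' z [m [n [-> -> ->]]] [m' [n' [-> -> /einj]]].
    by move=> /(pcan_inj pickleK) [-> ->].
(* Adjoining [G0] to every candidate keeps a countable set inside the domain and settles the empty
   chain. *)
have [F FP Ftot|G [PG Gmax]] := @Zorn_bigcup _ (fun G => pairing_graph (G0 `|` G)).
  have [->|/set0P[X0 FX0]] := eqVneq F set0; first by rewrite bigcup_set0 setU0.
  have -> : G0 `|` \bigcup_(X in F) X =
            \bigcup_(X in [set G0 `|` X | X in F]) X.
    apply/seteqP; split=> [x [h|[X FX Xx]]|x [_ [X FX <-] [h|h]]].
    - by exists (G0 `|` X0); [exists X0|left].
    - by exists (G0 `|` X); [exists X|right].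
    - by left.
    - by right; exists X.
  apply: pairing_graph_chain => [_ [X FX <-]|_ _ [X FX <-] [Y FY <-]].
    exact: FP.
  by case: (Ftot X Y FX FY) => h; [left|right] => x [|/h]; [left|right|left|right].
set H := G0 `|` G in PG; have [Hd Ht Hf Hi] := PG.
pose A := edge_dom H.
have Ae n : A (e n) by exists (e n), (e (pickle (n, n))); left; exists n, n.
have /choice[f fP] : forall u : T * T, exists z, A u.1 -> A u.2 -> H (u.1, u.2, z).
  case=> x y; have [[h1 h2]|h] := pselect (A x /\ A y).
    by have [z] := Ht _ _ h1 h2; exists z.
  by exists x => h1 h2; case: h.
have fA x y : A x -> A y -> A (f (x, y)).
  by move=> h1 h2; have [] := Hd _ _ _ (fP (x, y) h1 h2).
have fI x y x' y' : A x -> A y -> A x' -> A y' -> f (x, y) = f (x', y') -> x = x' /\ y = y'.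
  move=> h1 h2 h3 h4 E; have := fP (x, y) h1 h2; have := fP (x', y') h3 h4.
  by rewrite -E => /= u v; apply: Hi v u.
have [[g [gA gI]]|[g [gA gI]]] := card_comparable (~` A) A.
  pose k x := if pselect (A x) then f (e 0, x) else f (e 1, g x).
  have kA x : A (k x) by rewrite /k; case: pselect => h; apply: fA => //; apply: gA.
  have kI x y : k x = k y -> x = y.
    rewrite /k; case: pselect => hx; case: pselect => hy.
    - by case/(fI _ _ _ _ (Ae 0) hx (Ae 0) hy).
    - by case/(fI _ _ _ _ (Ae 0) hx (Ae 1) (gA _ hy)) => /einj.
    - by case/(fI _ _ _ _ (Ae 1) (gA _ hx) (Ae 0) hy) => /einj.
    - by case/(fI _ _ _ _ (Ae 1) (gA _ hx) (Ae 1) (gA _ hy)) => _ /gI->.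
  exists (fun u => f (k u.1, k u.2)) => -[x y] [x' y'] /= /fI[]// => /kI-> /kI->.
  by [].
exfalso.
pose B := [set g x | x in A].
have nAB x : B x -> ~ A x by move=> [y Ay <-]; apply: gA.
have /choice[r rP] : forall x, exists y, (A x -> y = x) /\ (B x -> A y /\ g y = x).
  move=> x; have [Ax|nAx] := pselect (A x); first by exists x; split=> // h; case: (nAB _ h).
  have [h|nB] := pselect (B x); last by exists x.
  by case: h => y Ay gy; exists y; split=> //.
have rA x : A x \/ B x -> A (r x).
  by case=> h; [rewrite (rP x).1|have [] := (rP x).2 h].
(* [tag] tells which of the new blocks A x B, B x A, B x B contains the pair, and [r] folds [B] back
   onto [A]. New pairs take values in [B], so they miss the old values. *)
pose tag x y := e (if pselect (A x) then 0 else if pselect (A y) then 1 else 2).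
have orB u : A u \/ B u -> ~ A u -> B u by case.
have rI x y x' y' : A x \/ B x -> A y \/ B y -> A x' \/ B x' -> A y' \/ B y' ->
    ~ (A x /\ A y) -> ~ (A x' /\ A y') ->
    tag x y = tag x' y' -> r x = r x' -> r y = r y' -> x = x' /\ y = y'.
  have same u v : (A u /\ A v) \/ (B u /\ B v) -> r u = r v -> u = v.
    move=> [[Au Av]|[Bu Bv]]; first by rewrite !(rP _).1.
    by have [_ {2}<-] := (rP u).2 Bu; have [_ {2}<-] := (rP v).2 Bv => ->.
  move=> hx hy hx' hy' n n' /einj E r1 r2; split; apply: same => //; move: E;
    do ?case: pselect => ?; move=> E; first [discriminate | by case: n
      | by case: n' | by left | right]; by split; apply: orB => // h; case: n || case: n'.
pose H' : set (T * T * T) := [set u | H u \/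
  [/\ A u.1.1 \/ B u.1.1, A u.1.2 \/ B u.1.2, ~ (A u.1.1 /\ A u.1.2) &
      u.2 = g (f (tag u.1.1 u.1.2, f (r u.1.1, r u.1.2)))]].
have Atag x y : A (tag x y) by rewrite /tag; apply: Ae.
have Bz x y : A x \/ B x -> A y \/ B y -> B (g (f (tag x y, f (r x, r y)))).
  move=> hx hy; exists (f (tag x y, f (r x, r y))) => //.
  by apply: (fA _ _ (Atag _ _)); apply: (fA _ _); apply: rA.
have HH' : H `<=` H' by move=> x; left.
have B0 : B (g (e 0)) by exists (e 0).
have dH' x : edge_dom H' x <-> A x \/ B x.
  split=> [[y [z [h|[h _ _ _]]]]|[[y [z h]]|h]]; [|exact: h| |].
  - by left; exists y, z.
  - by exists y, z; left.
  - exists x, (g (f (tag x x, f (r x, r x)))); right.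
    split=> /=; [tauto|tauto| |by []].
    by move=> [/(nAB _ h)].
apply: (Gmax H').
  split; first by move=> x Gx; left; right.
  pose b := g (e 0).
  move=> /(_ (b, b, g (f (tag b b, f (r b, r b))))) K.
  apply: (nAB _ B0); eexists; eexists; right; apply: K; right; split=> /=; [tauto|tauto| |by []].
  by move=> [/(nAB _ B0)].
rewrite [X in pairing_graph X](_ : _ = H'); last first.
  by apply/seteqP; split=> [x [h|//]|x]; [left; left|right].
split.
- move=> x y z [h|/= [hx hy _ ->]].
    by have [? ? ?] := Hd _ _ _ h; split; apply/dH'; left.
  by split; apply/dH' => //; right; apply: Bz.
- move=> x y /dH' hx /dH' hy; have [[h1 h2]|n] := pselect (A x /\ A y).
    by have [z h] := Ht _ _ h1 h2; exists z; left.
  by exists (g (f (tag x y, f (r x, r y)))); right; split.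
- move=> x y z z' [h1|/= [hx hy n1 ->]] [h2|/= [hx' hy' n2 ->]] //.
  + exact: Hf h1 h2.
  + by case: n2; have [? ? _] := Hd _ _ _ h1.
  + by case: n1; have [? ? _] := Hd _ _ _ h2.
- move=> x y x' y' z [h1|/= [hx hy n1 e1]] [h2|/= [hx' hy' n2 e2]].
  + exact: Hi h1 h2.
  + have [_ _ Az] := Hd _ _ _ h1.
    by case: (nAB z) => //; rewrite e2; apply: Bz.
  + have [_ _ Az] := Hd _ _ _ h2.
    by case: (nAB z) => //; rewrite e1; apply: Bz.
  + move: e2; rewrite e1 => /gI/fI[||||||t] //;
      try by do ?apply: (fA _ _); do ?apply: (rA _); rewrite ?Atag.
    by move=> /fI[||||r1 r2]; try exact: rA; apply: rI.
Qed.
End Square.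

End Cardinality.

(** * Terms over equivalence relations and their upper covers *)

Section EqRelFacts.
Variable T : Type.
Implicit Types R S E : equivrel T.

Lemma erel_refl R x : R x x. Proof. by case: (erel_equiv R). Qed.
Lemma erel_sym R x y : R x y -> R y x.
Proof. by case: (erel_equiv R) => _ + _; apply. Qed.
Lemma erel_trans R y x z : R x y -> R y z -> R x z.
Proof. by case: (erel_equiv R) => _ _; apply. Qed.

Lemma erel_leP R S : R <= S <-> (forall x y, R x y -> S x y).
Proof. by split=> [/eqrel_leP|h]; last exact/eqrel_leP. Qed.

Lemma erel_joinP R S x y :
  (R `|` S) x y <-> (forall E, R <= E -> S <= E -> E x y).
Proof.
split=> [h E /erel_leP RE /erel_leP SE|h E RE SE]; first exact: (h E RE SE).
by apply: h; apply/erel_leP.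
Qed.

Definition finite_support R :=
  exists l : list T, forall x y, R x y -> x = y \/ List.In x l /\ List.In y l.

Lemma restrict_equiv R (l : list T) :
  is_equivalence (fun x y => x = y \/ [/\ List.In x l, List.In y l & R x y]).
Proof.
split=> [x|x y [->|[hx hy h]]|x y z [->//|[hx hy h]] [<-|[hy' hz h']]].
- by left.
- by left.
- by right; split=> //; apply: erel_sym.
- by right.
- by right; split=> //; apply: erel_trans h h'.
Qed.
Definition restrict R l : equivrel T := EqRel (restrict_equiv R l).

Lemma restrict_fin R l : finite_support (restrict R l).
Proof. by exists l => x y [|[]]; [left|right]. Qed.

Lemma restrict_le R l : restrict R l <= R.
Proof. by apply/erel_leP => x y [->|[]//]; apply: erel_refl. Qed.

Lemma restrict_mono R l l' : (forall x, List.In x l -> List.In x l') ->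
  restrict R l <= restrict R l'.
Proof.
by move=> h; apply/erel_leP => x y [->|[hx hy r]]; [left|right; split; auto].
Qed.

(** A related pair is already seen by the restriction to its two points. *)
Lemma le_restricts R S : (forall l, restrict R l <= S) -> R <= S.
Proof.
move=> h; apply/erel_leP => x y r; have /erel_leP := h [:: x; y]; apply.
by right; split=> //=; auto.
Qed.

Lemma finite_support_join R S :
  finite_support R -> finite_support S -> finite_support (R `|` S).
Proof.
move=> [l hl] [m hm]; exists (l ++ m)%list => x y /erel_joinP.
move=> /(_ (restrict (\top : equivrel T) (l ++ m)%list)) [||->|[]]; rewrite /=; auto.
- apply/erel_leP => {}x {}y /hl [->|[h1 h2]]; first by left.
  by right; split=> //; apply: List.in_or_app; left.
- apply/erel_leP => {}x {}y /hm [->|[h1 h2]]; first by left.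
  by right; split=> //; apply: List.in_or_app; right.
Qed.

Lemma finite_support_meet R S : finite_support R -> finite_support (R `&` S).
Proof. by move=> [l hl]; exists l => x y [/hl]. Qed.

Lemma finite_support_bot : finite_support (\bot : equivrel T).
Proof. by exists nil => x y ->; left. Qed.

Lemma finite_support_gen R : finite_support R ->
  exists l : list (T * T), (forall u, List.In u l -> R u.1 u.2) /\
    forall E, (forall u, List.In u l -> E u.1 u.2) -> R <= E.
Proof.
move=> [l hl].
pose f (u : T * T) := `[< R u.1 u.2 >].
exists (List.filter f (List.list_prod l l)); split.
  by move=> u /List.filter_In [_ /asboolP].
move=> E h; apply/erel_leP => x y r; have [->|[hx hy]] := hl _ _ r.
  exact: erel_refl.
by apply: (h (x, y)); apply/List.filter_In; split; [exact: List.in_prod|exact/asboolP].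
Qed.

(** These are the compact elements of the lattice of equivalence relations. *)
Record fineq := FinEq { fe :> equivrel T; feP : finite_support fe }.

End EqRelFacts.

Inductive term (I E : Type) :=
| Leaf of I & E
| Mt of term I E & term I E
| Jn of term I E & term I E.

Fixpoint eval I E d (M : latticeType d) (h : I -> E -> M) (p : term I E) : M :=
  match p with
  | Leaf i e => h i e
  | Mt s t => eval h s `&` eval h t
  | Jn s t => eval h s `|` eval h t
  end.

Fixpoint indices I E (p : term I E) : list I :=
  match p with
  | Leaf i e => [:: i]
  | Mt s t | Jn s t => (indices s ++ indices t)%list
  end.

Lemma indices_neq0 I E (p : term I E) : exists i, List.In i (indices p).
Proof.
elim: p => [i e|s [i h] t _|s [i h] t _]; exists i => /=; first by left.
  by apply: List.in_or_app; left.
by apply: List.in_or_app; left.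
Qed.

Section UpperCover.
Variables (Om J E : Type) (v : E -> equivrel Om).
Implicit Types a b : option (equivrel Om).

(** [None] acts as a new top element above all equivalence relations. *)
Definition ole a b : Prop :=
  match b, a with None, _ => True | Some U, Some R => R <= U | Some _, None => False end.

Definition omeet a b := match a, b with
  | Some R, Some U => Some (R `&` U) | None, _ => b | _, None => a end.
Definition ojoin a b := match a, b with
  | Some R, Some U => Some (R `|` U) | _, _ => None end.

Lemma ole_refl a : ole a a. Proof. by case: a => //=. Qed.
Lemma ole_trans b a c : ole a b -> ole b c -> ole a c.
Proof. by case: a b c => [?|] [?|] [?|] //=; apply: le_trans. Qed.
Lemma omeet_lel a b : ole (omeet a b) a.
Proof. by case: a b => [?|] [?|] //=; apply: leIl. Qed.
Lemma omeet_ler a b : ole (omeet a b) b.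
Proof. by case: a b => [?|] [?|] //=; apply: leIr. Qed.
Lemma le_omeet a b c : ole c a -> ole c b -> ole c (omeet a b).
Proof. by case: a b c => [?|] [?|] [?|] //=; rewrite lexI => -> ->. Qed.
Lemma ojoinP a b c : ole (ojoin a b) c <-> ole a c /\ ole b c.
Proof.
case: a b c => [?|] [?|] [?|] //=; rewrite ?leUx; try tauto.
by split=> /andP.
Qed.
Lemma ole_bot a : ole (Some \bot) a. Proof. by case: a => [?|] //=; apply: le0x. Qed.
Lemma ole_botP a : ole a (Some \bot) -> a = Some \bot.
Proof. by case: a => //= R; rewrite lex0 => /eqP->. Qed.
Lemma omeet0 a : omeet a (Some \bot) = Some \bot.
Proof. by case: a => [?|] //=; rewrite meetx0. Qed.
Lemma omeet_mono a b a' b' : ole a a' -> ole b b' -> ole (omeet a b) (omeet a' b').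
Proof.
move=> h1 h2; apply: le_omeet; [apply: ole_trans h1|apply: ole_trans h2].
  exact: omeet_lel.
exact: omeet_ler.
Qed.

(* [up p j] is the upper cover of [p] in the [j]th factor, i.e. the least
   element of that factor above [p], with [None] when there is none.  In a
   coproduct with zero a meet that is sent to zero in one factor is zero. *)
Fixpoint up (p : term J E) (j : J) : option (equivrel Om) :=
  match p with
  | Leaf i e => if pselect (i = j \/ v e = \bot) then Some (v e) else None
  | Mt s t =>
      if pselect (exists i, omeet (up s i) (up t i) = Some \bot) then Some \bot
      else omeet (up s j) (up t j)
  | Jn s t => ojoin (up s j) (up t j)
  end.

(** The factors share their zero: the clauses for leaves and meets produce a zero cover
    independently of the index. *)
Lemma up_zero p j i : up p j = Some \bot -> up p i = Some \bot.
Proof.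
elim: p => [k e|s _ t _|s IHs t IHt] /=.
- case: pselect => [?|?] /= => [[h]|//]; case: pselect => [?|[]] /=; rewrite h //; by right.
- by case: pselect => h1 /= h2 //; case: h1; exists j.
- move=> h; have /ojoinP[/ole_botP/IHs-> /ole_botP/IHt->] :
    ole (ojoin (up s j) (up t j)) (Some \bot) by rewrite h; apply: ole_refl.
  by rewrite /= joinxx.
Qed.

Lemma up_outside p j : ~ List.In j (indices p) ->
  up p j = None \/ up p j = Some \bot.
Proof.
elim: p => [k e|s IHs t IHt|s IHs t IHt] /=.
- by case: pselect => [[h|h]|h] /= n; [case: n; left|right; rewrite h|left].
- move=> h; have {}IHs := IHs (fun hs => h (List.in_or_app _ _ _ (or_introl hs))).
  have {}IHt := IHt (fun ht => h (List.in_or_app _ _ _ (or_intror ht))).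
  case: pselect => h1 /=; first by right.
  by case: IHs IHt => [->|->] [->|->] /=; rewrite ?meetxx; auto.
- move=> h; have {}IHs := IHs (fun hs => h (List.in_or_app _ _ _ (or_introl hs))).
  have {}IHt := IHt (fun ht => h (List.in_or_app _ _ _ (or_intror ht))).
  by case: IHs IHt => [->|->] [->|->] /=; rewrite ?joinxx; auto.
Qed.

(** Confines the choice of a factor to the finitely many indices of [p], so that a factor found for
    each approximation can later be chosen once for all. *)
Lemma up_indices p j R : ole (up p j) (Some R) ->
  exists2 i, List.In i (indices p) & i = j \/ forall i, up p i = Some \bot.
Proof.
move=> h; have [hj|/up_outside[h0|h0]] := pselect (List.In j (indices p)).
- by exists j; auto.
- by rewrite h0 in h.
- have [i hi] := indices_neq0 p; exists i => //; right=> k; exact: up_zero h0.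
Qed.

Lemma up_finite p j R : (forall e, finite_support (v e)) ->
  up p j = Some R -> finite_support R.
Proof.
move=> fin; elim: p R => [k e|s IHs t IHt|s IHs t IHt] R /=.
- by case: pselect => ? //= [<-].
- case: pselect => [? [<-]|? /=]; first exact: finite_support_bot.
  case: (up s j) (up t j) IHs IHt => [A|] [B|] //= IHs IHt [<-]; auto.
  by apply: finite_support_meet; auto.
- case: (up s j) (up t j) IHs IHt => [A|] [B|] //= IHs IHt [<-].
  by apply: finite_support_join; auto.
Qed.

Lemma up_Mtl s t j : ole (up (Mt s t) j) (up s j).
Proof. by rewrite /=; case: pselect => ?; [apply: ole_bot|apply: omeet_lel]. Qed.

Lemma up_Mtr s t j : ole (up (Mt s t) j) (up t j).
Proof. by rewrite /=; case: pselect => ?; [apply: ole_bot|apply: omeet_ler]. Qed.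

End UpperCover.

(** * Finite approximations of terms *)

Section Approx.
Variables (Om J E : Type) (v : E -> equivrel Om).
Notation T := (term J (fineq Om)).

Definition tup (s : T) j := up (@fe Om) s j.

Fixpoint apx (p : term J E) (l : list Om) : T :=
  match p with
  | Leaf j e => Leaf j (FinEq (restrict_fin (v e) l))
  | Mt s t => Mt (apx s l) (apx t l)
  | Jn s t => Jn (apx s l) (apx t l)
  end.

Lemma indices_apx p l : indices (apx p l) = indices p.
Proof. by elim: p => //= s -> t ->. Qed.

(** The order in which [apx p l] grows with [l]. *)
Fixpoint tle (s t : T) : Prop :=
  match s, t with
  | Leaf i k, Leaf j k' => i = j /\ fe k <= fe k'
  | Mt s1 s2, Mt t1 t2 | Jn s1 s2, Jn t1 t2 => tle s1 t1 /\ tle s2 t2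
  | _, _ => False
  end.

Lemma tle_up s t j : tle s t -> ole (tup s j) (tup t j).
Proof.
rewrite /tup; elim: s t j => [i k|s1 IH1 s2 IH2|s1 IH1 s2 IH2] [i' k'|t1 t2|t1 t2] j //=.
- move=> [<- h]; case: pselect => [h1|h1]; case: pselect => [h2|h2] //=.
  by case: h1; case: h2; auto => h2; right; apply/eqP; rewrite -lex0 -h2.
- move=> [h1 h2]; case: pselect => [h3|h3]; case: pselect => [h4|h4] //=.
  + exact: ole_bot.
  + case: h3; have [i h5] := h4; exists i; apply: ole_botP.
    by rewrite -h5; apply: omeet_mono; [apply: IH1|apply: IH2].
  + by apply: omeet_mono; [apply: IH1|apply: IH2].
- move=> [h1 h2]; apply/ojoinP; split.
  + apply: ole_trans (IH1 _ _ h1) _.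
    by case: (up _ t1 j) (up _ t2 j) => [?|] [?|] //=; apply: leUl.
  + apply: ole_trans (IH2 _ _ h2) _.
    by case: (up _ t1 j) (up _ t2 j) => [?|] [?|] //=; apply: leUr.
Qed.

Lemma tle_apx p l l' : (forall x, List.In x l -> List.In x l') ->
  tle (apx p l) (apx p l').
Proof. by move=> h; elim: p => //= j e; split=> //; apply: restrict_mono. Qed.

End Approx.

(** * Compactness along finite lists *)

Section Directed.
Variable Om : Type.

Definition antitone (P : list Om -> Prop) :=
  forall l l', (forall x, List.In x l -> List.In x l') -> P l' -> P l.

(** Failures of [P] at [l] and of [Q] at [m] would both persist at [l ++ m]. *)
Lemma antitone_or (P Q : list Om -> Prop) : antitone P -> antitone Q ->
  (forall l, P l \/ Q l) -> (forall l, P l) \/ (forall l, Q l).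
Proof.
move=> aP aQ h; apply: contrapT => /not_orP [/existsNP[l nl] /existsNP[m nm]].
have [hp|hq] := h (l ++ m)%list.
  by apply: nl; apply: aP hp => x hx; apply: List.in_or_app; left.
by apply: nm; apply: aQ hq => x hx; apply: List.in_or_app; right.
Qed.

Lemma antitone_exists A (s : list A) (P : A -> list Om -> Prop) :
  (forall a, antitone (P a)) ->
  (forall l, exists2 a, List.In a s & P a l) ->
  exists2 a, List.In a s & forall l, P a l.
Proof.
move=> aP; elim: s => [|a s IH] h; first by have [] := h nil.
have [||l|h1|h1] := @antitone_or (P a) (fun l => exists2 b, List.In b s & P b l).
- exact: aP.
- by move=> l l' hl [b hb /(aP b _ _ hl) hp]; exists b.
- by have [b [<-|hb] hp] := h l; [left|right; exists b].
- by exists a => //; left.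
- by have [b hb hp] := IH h1; exists b => //; right.
Qed.

Definition monotone (a : list Om -> option (equivrel Om)) :=
  forall l l', (forall x, List.In x l -> List.In x l') -> ole (a l) (a l').

(** For a monotone family without [None] this is the directed union; a value [None] counts as the
    full relation. *)
Definition union_rel (a : list Om -> option (equivrel Om)) x y :=
  exists l, if a l is Some R then R x y else True.

Lemma union_equiv a : monotone a -> is_equivalence (union_rel a).
Proof.
move=> ma; split=> [x|x y [l h]|x y z [l h1] [l' h2]].
- by exists nil; case: (a nil) => // R; apply: erel_refl.
- by exists l; case: (a l) h => // R; apply: erel_sym.
- exists (l ++ l')%list.
  have := ma l (l ++ l')%list (fun x hx => List.in_or_app _ _ _ (or_introl hx)).
  have := ma l' (l ++ l')%list (fun x hx => List.in_or_app _ _ _ (or_intror hx)).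
  case: (a (l ++ l')%list) => // R; case: (a l) (a l') h1 h2 => [A|] [B|] //= h1 h2.
  by move=> /erel_leP/(_ _ _ h2) + /erel_leP/(_ _ _ h1) => h3 h4; apply: erel_trans h4 h3.
Qed.

(* Holds because meets of equivalence relations commute with directed unions. *)
Lemma omeet_continuous a b A B : monotone a -> monotone b ->
  (forall R, (forall l, ole (a l) (Some R)) -> ole A (Some R)) ->
  (forall R, (forall l, ole (b l) (Some R)) -> ole B (Some R)) ->
  forall R, (forall l, ole (omeet (a l) (b l)) (Some R)) -> ole (omeet A B) (Some R).
Proof.
move=> ma mb hA hB R h.
have inl (l l' : list Om) x : List.In x l -> List.In x (l ++ l')%list.
  by move=> ?; apply: List.in_or_app; left.
have inr (l l' : list Om) x : List.In x l' -> List.In x (l ++ l')%list.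
  by move=> ?; apply: List.in_or_app; right.
(* A family that reaches [None] stays there by monotonicity, so the meets eventually agree with the
   other family. *)
have [[l0 al0]|na] := pselect (exists l, a l = None).
  apply: (ole_trans (omeet_ler _ _)); apply: hB => l.
  have := h (l0 ++ l)%list; have := ma _ _ (inl l0 l); rewrite al0.
  case: (a _) => // _; rewrite [omeet _ _]/=; apply: ole_trans; apply: mb.
  exact: inr.
have [[l0 bl0]|nb] := pselect (exists l, b l = None).
  apply: (ole_trans (omeet_lel _ _)); apply: hA => l.
  have := h (l ++ l0)%list; have := mb _ _ (inr l l0); rewrite bl0.
  case: (b _) => // _; case E: (a _) => [S|]; last by case: na; exists (l ++ l0)%list.
  by rewrite [omeet _ _]/= -E; apply: ole_trans; apply: ma; apply: inl.
have {}hA : ole A (Some (EqRel (union_equiv ma))).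
  apply: hA => l; case E: (a l) => [S|]; last by case: na; exists l.
  by apply/erel_leP => x y s; exists l; rewrite E.
have {}hB : ole B (Some (EqRel (union_equiv mb))).
  apply: hB => l; case E: (b l) => [S|]; last by case: nb; exists l.
  by apply/erel_leP => x y s; exists l; rewrite E.
apply: ole_trans (omeet_mono hA hB) _; apply/erel_leP => x y [[l hl] [m hm]].
have := h (l ++ m)%list; have := ma _ _ (inl l m); have := mb _ _ (inr l m).
case E1: (a l) hl => [A1|] hl; last by case: na; exists l.
case E2: (b m) hm => [B1|] hm; last by case: nb; exists m.
case E3: (a _) => [A2|]; last by case: na; exists (l ++ m)%list.
case E4: (b _) => [B2|]; last by case: nb; exists (l ++ m)%list.
move=> /= /erel_leP/(_ _ _ hm) h1 /erel_leP/(_ _ _ hl) h2 /erel_leP; apply.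
by split.
Qed.

End Directed.

(** * Closed sets of finite terms and the word problem *)

Section ClosedSets.
Variables (Om J : Type).
Notation T := (term J (fineq Om)).
Implicit Types s t : T.

(* The algebraic lattice in which the factors get embedded: a closed set is an
   ideal of finite terms, and [tr V j] is its trace on the [j]th factor.  The
   terms [Mt s t] are only required to lie below [s] and [t]. *)
Record cset := CSet {
  car :> T -> Prop;
  tr : J -> equivrel Om;
  carL : forall j (k : fineq Om), car (Leaf j k) <-> fe k <= tr j;
  carJ : forall s t, car (Jn s t) <-> car s /\ car t;
  carMl : forall s t, car s -> car (Mt s t);
  carMr : forall s t, car t -> car (Mt s t);
  carU : forall j s, ole (tup s j) (Some (tr j)) -> car s }.
Implicit Types V : cset.

Lemma tr_mono V1 V2 j : (forall s, V1 s -> V2 s) -> tr V1 j <= tr V2 j.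
Proof.
move=> h; apply: le_restricts => l.
suff /h /carL : V1 (Leaf j (FinEq (restrict_fin (tr V1 j) l))) by [].
by apply/carL; apply: restrict_le.
Qed.

Section Factor.
Variables (j : J) (R : equivrel Om).
Definition ftr i : equivrel Om := if pselect (j = i) then R else \bot.
Definition fcar s := ole (tup s j) (Some R).

Lemma fcarL i (k : fineq Om) : fcar (Leaf i k) <-> fe k <= ftr i.
Proof.
rewrite /fcar /ftr /tup /=; case: pselect => [[h|h]|h] /=.
- by case: pselect => [|[]].
- by rewrite h !le0x.
- case: pselect => [e|n] /=; first by case: h; left.
  by rewrite lex0; split=> // /eqP e; case: h; right.
Qed.

Lemma fcarJ s t : fcar (Jn s t) <-> fcar s /\ fcar t.
Proof. exact: ojoinP. Qed.

Lemma fcarMl s t : fcar s -> fcar (Mt s t).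
Proof.
exact: ole_trans (up_Mtl _ _ _ _).
Qed.

Lemma fcarMr s t : fcar t -> fcar (Mt s t).
Proof.
exact: ole_trans (up_Mtr _ _ _ _).
Qed.

Lemma fcarU i s : ole (tup s i) (Some (ftr i)) -> fcar s.
Proof.
rewrite /ftr; case: pselect => [e|n] /=; first by rewrite /fcar e.
move=> h0; have h := up_zero j (ole_botP h0).
by rewrite /fcar /tup h; apply: le0x.
Qed.

Definition fset : cset := CSet fcarL fcarJ fcarMl fcarMr fcarU.
End Factor.

Section Meet.
Variables V1 V2 : cset.
Definition mtr j := tr V1 j `&` tr V2 j.
Definition mcar s := V1 s /\ V2 s.

Lemma mcarL i (k : fineq Om) : mcar (Leaf i k) <-> fe k <= mtr i.
Proof.
rewrite /mcar /mtr lexI !carL; split=> [[-> ->]//|/andP//].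
Qed.
Lemma mcarJ s t : mcar (Jn s t) <-> mcar s /\ mcar t.
Proof. by rewrite /mcar !carJ; tauto. Qed.
Lemma mcarMl s t : mcar s -> mcar (Mt s t).
Proof. by move=> [h1 h2]; split; apply: carMl. Qed.
Lemma mcarMr s t : mcar t -> mcar (Mt s t).
Proof. by move=> [h1 h2]; split; apply: carMr. Qed.
Lemma mcarU i s : ole (tup s i) (Some (mtr i)) -> mcar s.
Proof.
move=> h; split; apply: (@carU _ i); apply: ole_trans h _ => /=.
  exact: leIl.
exact: leIr.
Qed.
Definition cmeet : cset := CSet mcarL mcarJ mcarMl mcarMr mcarU.
End Meet.

Section Join.
Variables V1 V2 : cset.
Definition jtr j := tr V1 j `|` tr V2 j.
(** A meet enters the join by the alternatives of Whitman's condition; the last one interposes an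
    element of a factor between the term and the join. *)
Fixpoint jcar s : Prop :=
  match s with
  | Leaf j k => fe k <= jtr j
  | Jn s t => jcar s /\ jcar t
  | Mt s t => [\/ V1 (Mt s t) \/ V2 (Mt s t), jcar s, jcar t |
                exists j, ole (tup (Mt s t) j) (Some (jtr j))]
  end.

Lemma jcarMl s t : jcar s -> jcar (Mt s t).
Proof. by move=> h; constructor 2. Qed.
Lemma jcarMr s t : jcar t -> jcar (Mt s t).
Proof. by move=> h; constructor 3. Qed.
Lemma jcarU i s : ole (tup s i) (Some (jtr i)) -> jcar s.
Proof.
elim: s => [j k|s IHs t IHt|s IHs t IHt].
- by rewrite /tup /=; case: pselect => [[h|h]|h] //=; rewrite h ?le0x.
- by move=> h; constructor 4; exists i.
- by move=> /(@ojoinP _ (tup s i) (tup t i))[h1 h2]; split; auto.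
Qed.
Definition cjoin : cset :=
  @CSet jcar jtr (fun _ _ => iff_refl _) (fun _ _ => iff_refl _) jcarMl jcarMr jcarU.

Lemma cjoinl s : V1 s -> cjoin s.
Proof.
elim: s => [j k|s IHs t IHt|s IHs t IHt] /=.
- by move=> /carL h; apply: le_trans h _; apply: leUl.
- by move=> h; constructor 1; left.
- by move=> /carJ[a b]; split; [apply: IHs|apply: IHt].
Qed.
Lemma cjoinr s : V2 s -> cjoin s.
Proof.
elim: s => [j k|s IHs t IHt|s IHs t IHt] /=.
- by move=> /carL h; apply: le_trans h _; apply: leUr.
- by move=> h; constructor 1; right.
- by move=> /carJ[a b]; split; [apply: IHs|apply: IHt].
Qed.

Lemma cjoin_min V : (forall s, V1 s -> V s) -> (forall s, V2 s -> V s) ->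
  forall s, cjoin s -> V s.
Proof.
move=> h1 h2; have htr j : jtr j <= tr V j by rewrite leUx !tr_mono.
elim=> [j k|s IHs t IHt|s IHs t IHt].
- by move=> h; apply/carL; apply: le_trans h _.
- move=> [[]|/IHs|/IHt|[j h]]; auto; [exact: carMl|exact: carMr|].
  by apply: (@carU _ j); apply: ole_trans h _; apply: htr.
- by move=> [? ?]; apply/carJ; auto.
Qed.

Variable j0 : J.
Definition bot : T := Leaf j0 (FinEq (@finite_support_bot Om)).
Lemma car_bot V : V bot. Proof. by apply/carL => /=; apply: le0x. Qed.

(** Pairs forced into the [j]th trace by one term of [V1] and one of [V2]. They form an equivalence
    relation because [Jn] collects several witnesses into one. *)
Definition witness_tr j x y := exists s t, [/\ V1 s, V2 t &
  forall V, V s -> V t -> tr V j x y].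

Lemma witness_equiv j : is_equivalence (witness_tr j).
Proof.
split=> [x|x y [s [t [h1 h2 h]]]|x y z [s [t [h1 h2 h]]] [s' [t' [h1' h2' h']]]].
- exists bot, bot; split; [exact: car_bot|exact: car_bot|].
  by move=> *; apply: erel_refl.
- by exists s, t; split=> // V a b; apply: erel_sym; apply: h.
- exists (Jn s s'), (Jn t t'); split; [exact/carJ|exact/carJ|].
  by move=> V /carJ[a a'] /carJ[b b']; apply: erel_trans (h V a b) (h' V a' b').
Qed.

Lemma witness_leaf j (R : equivrel Om) x y V :
  V (Leaf j (FinEq (restrict_fin R [:: x; y]))) -> R x y -> tr V j x y.
Proof. by move=> /carL/erel_leP h r; apply: h; right; split=> //=; auto. Qed.

Lemma cjoin_finitary_le j R : finite_support R -> R <= jtr j ->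
  exists s t, [/\ V1 s, V2 t & forall V, V s -> V t -> R <= tr V j].
Proof.
move=> finR leR.
have {}leR : R <= EqRel (witness_equiv j).
  apply: le_trans leR _; rewrite leUx; apply/andP; split; apply/erel_leP => x y r.
  - exists (Leaf j (FinEq (restrict_fin (tr V1 j) [:: x; y]))), bot.
    split; [by apply/carL; apply: restrict_le|exact: car_bot|].
    by move=> V /witness_leaf h _; apply: h.
  - exists bot, (Leaf j (FinEq (restrict_fin (tr V2 j) [:: x; y]))).
    split; [exact: car_bot|by apply/carL; apply: restrict_le|].
    by move=> V _ /witness_leaf h; apply: h.
have [l [hl genR]] := finite_support_gen finR.
suff [s [t [h1 h2 h]]] : exists s t, [/\ V1 s, V2 t &
    forall V, V s -> V t -> forall u, List.In u l -> tr V j u.1 u.2].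
  by exists s, t; split=> // V a b; apply: genR; apply: h.
have {}hl u : List.In u l -> witness_tr j u.1 u.2.
  by move=> /hl; move/erel_leP: leR; apply.
elim: l hl {genR} => [|u l IH] hl.
  by exists bot, bot; split; [exact: car_bot|exact: car_bot|].
have [s [t [h1 h2 h]]] := hl u (or_introl erefl).
have [|s' [t' [h1' h2' h']]] := IH; first by move=> w hw; apply: hl; right.
exists (Jn s s'), (Jn t t'); split; [exact/carJ|exact/carJ|].
move=> V /carJ[a a'] /carJ[b b'] w [<-|]; first exact: h.
exact: h'.
Qed.

(** Membership in a join depends on a single term from each side. This supplies the two distances
    [a], [b] of the paths that realise joins of equivalence relations. *)
Lemma cjoin_finitary r : cjoin r ->
  exists s t, [/\ V1 s, V2 t & forall V, V s -> V t -> V r].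
Proof.
elim: r => [j k|r1 IH1 r2 IH2|r1 IH1 r2 IH2].
- move=> /carL /(cjoin_finitary_le (feP k)) [s [t [h1 h2 h]]].
  by exists s, t; split=> // V a b; apply/carL; apply: h.
- case=> [[h|h]|/IH1[s [t [h1 h2 h]]]|/IH2[s [t [h1 h2 h]]]|[j]].
  + by exists (Mt r1 r2), bot; split=> //; apply: car_bot.
  + by exists bot, (Mt r1 r2); split=> //; apply: car_bot.
  + by exists s, t; split=> // V a b; apply: carMl; apply: h.
  + by exists s, t; split=> // V a b; apply: carMr; apply: h.
  + case E: (tup (Mt r1 r2) j) => [R|] // hR.
    have finR : finite_support R by apply: up_finite E => k; apply: feP.
    have [s [t [h1 h2 h]]] := cjoin_finitary_le finR hR.
    exists s, t; split=> // V a b; apply: (@carU _ j); rewrite E; exact: h.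
- move=> /carJ [/IH1[s [t [h1 h2 h]]] /IH2[s' [t' [h1' h2' h']]]].
  exists (Jn s s'), (Jn t t'); split; [exact/carJ|exact/carJ|].
  by move=> V /carJ[a a'] /carJ[b b']; apply/carJ; split; [apply: h|apply: h'].
Qed.
End Join.

End ClosedSets.

(** * The word problem for coproducts with zero *)

Section WordProblem.
Variables (Om J : Type) (d : Order.disp_t) (L : bLatticeType d).
Variable val : L -> equivrel Om.
Hypothesis val_emb : lattice0_embedding val.
Variables (dM : Order.disp_t) (M : bLatticeType dM) (h : J -> L -> M).
Hypothesis h_hom : forall j, lattice0_hom (h j).
Notation W := (term J L).

Lemma hom_mono d1 d2 (A : latticeType d1) (B : latticeType d2) (g : A -> B) x y :
  lattice_hom g -> x <= y -> g x <= g y.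
Proof. by move=> gh /meet_idPl e; rewrite -e (gh x y).1 leIr. Qed.

Let valI x y : val (x `&` y) = val x `&` val y. Proof. exact: (val_emb.1.1 x y).1. Qed.
Let valU x y : val (x `|` y) = val x `|` val y. Proof. exact: (val_emb.1.1 x y).2. Qed.
Let val0 : val \bot = \bot. Proof. exact: val_emb.1.2. Qed.
Let val_le x y : val x <= val y -> x <= y.
Proof. by move=> /meet_idPl; rewrite -valI => /val_emb.2/meet_idPl. Qed.
Let hI j x y : h j (x `&` y) = h j x `&` h j y. Proof. exact: ((h_hom j).1 x y).1. Qed.
Let hU j x y : h j (x `|` y) = h j x `|` h j y. Proof. exact: ((h_hom j).1 x y).2. Qed.
Let h0 j : h j \bot = \bot. Proof. exact: (h_hom j).2. Qed.

Fixpoint ev (q : W) : cset Om J :=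
  match q with
  | Leaf j x => fset j (val x)
  | Mt s t => cmeet (ev s) (ev t)
  | Jn s t => cjoin (ev s) (ev t)
  end.

Lemma ev_tle q s t : tle s t -> ev q t -> ev q s.
Proof.
elim: q s t => [j x|q1 IH1 q2 IH2|q1 IH1 q2 IH2] s t st.
- exact: ole_trans (tle_up _ st).
- by move=> [a b]; split; [exact: IH1 st a|exact: IH2 st b].
- elim: s t st => [i k|s1 IHs1 s2 IHs2|s1 IHs1 s2 IHs2] [j l|t1 t2|t1 t2] //= st.
  + by case: st => <-; apply: le_trans.
  + case=> [[g|g]|g|g|[j g]].
    * by constructor 1; left; apply: (IH1 (Mt s1 s2) (Mt t1 t2) st).
    * by constructor 1; right; apply: (IH2 (Mt s1 s2) (Mt t1 t2) st).
    * by constructor 2; apply: IHs1 g; apply: st.1.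
    * by constructor 3; apply: IHs2 g; apply: st.2.
    * constructor 4; exists j.
      have h' := @tle_up _ _ (Mt s1 s2) (Mt t1 t2) j st.
      exact: (ole_trans (c := Some (jtr (ev q1) (ev q2) j)) h' g).
  + by case=> g1 g2; split; [apply: IHs1 g1; apply: st.1|apply: IHs2 g2; apply: st.2].
Qed.

Lemma ev_apx p l : ev p (apx val p l).
Proof.
elim: p => [j x|p1 IH1 p2 IH2|p1 IH1 p2 IH2].
- by apply/carL; rewrite /= /ftr; case: pselect => [e|[]] //=; apply: restrict_le.
- by split; [apply: carMl|apply: carMr].
- by apply/carJ; split; [apply: cjoinl|apply: cjoinr].
Qed.

(** The traces of [ev q] play the role of lower covers: meets and joins of traces stay in the image
    of [val], and [h j] preserves them. *)
Lemma lower_cover q j : exists2 x, tr (ev q) j = val x & h j x <= eval h q.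
Proof.
elim: q => [i x|q1 [x1 e1 l1] q2 [x2 e2 l2]|q1 [x1 e1 l1] q2 [x2 e2 l2]] /=.
- rewrite /ftr; case: pselect => [e|n] /=; first by exists x => //; rewrite e.
  by exists \bot; rewrite ?val0 // h0 le0x.
- by exists (x1 `&` x2); rewrite /mtr ?e1 ?e2 ?valI // hI leI2.
- by exists (x1 `|` x2); rewrite /jtr ?e1 ?e2 ?valU // hU leU2.
Qed.

(** The clause of [up] that sends a meet to zero is sound because [h i] preserves zero: a meet
    bounded by zero in factor [i] is zero in [M]. *)
Lemma upper_cover p j R : up val p j = Some R ->
  exists2 x, R = val x & eval h p <= h j x.
Proof.
elim: p j R => [i x|p1 IH1 p2 IH2|p1 IH1 p2 IH2] j R /=.
- case: pselect => [[e|e]|e] //= [<-]; exists x => //; first by rewrite e.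
  by rewrite (_ : x = \bot) ?h0 ?le0x //; apply: val_emb.2; rewrite val0.
- case: pselect => [e /= [<-]|n /=].
    exists \bot; rewrite ?val0 // h0; have [i ei] := e.
    case E1: (up val p1 i) (IH1 i) ei => [R1|] I1; case E2: (up val p2 i) (IH2 i) => [R2|] I2 //=.
    + have [x1 e1 l1] := I1 _ erefl; have [x2 e2 l2] := I2 _ erefl.
      move=> e0'; have e0 : x1 `&` x2 = \bot.
        by apply: val_emb.2; rewrite valI val0 -e1 -e2; exact: Some_inj e0'.
      by rewrite -(h0 i) -e0 hI leI2.
    + move=> [] e0; have [x1 e1 l1] := I1 _ erefl.
      apply: le_trans (leIl _ _) _; apply: le_trans l1 _.
      by rewrite (_ : x1 = \bot) ?h0 //; apply: val_emb.2; rewrite val0 -e0.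
    + move=> [] e0; have [x2 e2 l2] := I2 _ erefl.
      apply: le_trans (leIr _ _) _; apply: le_trans l2 _.
      by rewrite (_ : x2 = \bot) ?h0 //; apply: val_emb.2; rewrite val0 -e0.
  case E1: (up val p1 j) (IH1 j) => [R1|] I1; case E2: (up val p2 j) (IH2 j) => [R2|] I2 //= [<-].
  + have [x1 e1 l1] := I1 _ erefl; have [x2 e2 l2] := I2 _ erefl.
    by exists (x1 `&` x2); rewrite ?e1 ?e2 ?valI // hI leI2.
  + by have [x1 e1 l1] := I1 _ erefl; exists x1 => //; apply: le_trans (leIl _ _) l1.
  + by have [x2 e2 l2] := I2 _ erefl; exists x2 => //; apply: le_trans (leIr _ _) l2.
- case E1: (up val p1 j) (IH1 j) => [R1|] I1; case E2: (up val p2 j) (IH2 j) => [R2|] I2 //= [<-].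
  have [x1 e1 l1] := I1 _ erefl; have [x2 e2 l2] := I2 _ erefl.
  by exists (x1 `|` x2); rewrite ?e1 ?e2 ?valU // hU leU2.
Qed.

Lemma tup_apx_mono (p : W) (j : J) : monotone (fun l => tup (apx val p l) j).
Proof. by move=> l l' hl; apply: tle_up; apply: tle_apx. Qed.

(** For a meet, each approximation vanishes in some factor or has its [j]th meet of covers below
    [R]. By directedness one alternative holds throughout, the vanishing factor can be fixed among
    finitely many, and [omeet_continuous] passes to the limit. *)
Lemma up_continuous (p : W) j R : (forall l, ole (tup (apx val p l) j) (Some R)) ->
  ole (up val p j) (Some R).
Proof.
elim: p j R => [i x|p1 IH1 p2 IH2|p1 IH1 p2 IH2] j R hl.
- have [ij|nij] := pselect (i = j).
    rewrite /=; case: pselect => [?|[]]; last by left.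
    apply: le_restricts => l; move: (hl l); rewrite /tup /=.
    by case: pselect => // -[]; left.
  have vx : val x = \bot.
    apply/eqP; rewrite -lex0; apply: le_restricts => l; move: (hl l); rewrite /tup /=.
    by case: pselect => [[//|e]|] //= _; rewrite e lexx.
  rewrite /=; case: pselect => [?|[]]; last by right.
  by rewrite /= vx le0x.
- have mt l : ole (tup (apx val (Mt p1 p2) l) j) (Some R) ->
      (exists i, omeet (tup (apx val p1 l) i) (tup (apx val p2 l) i) = Some \bot)
      \/ ole (omeet (tup (apx val p1 l) j) (tup (apx val p2 l) j)) (Some R).
    by rewrite /tup /=; case: pselect => //= e g; [left|right].
  have mono i := omeet_mono (tup_apx_mono _ i _) (tup_apx_mono _ i _).
  have [||l|hZ|hM] := @antitone_or Om
    (fun l => exists i, omeet (tup (apx val p1 l) i) (tup (apx val p2 l) i) = Some \bot)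
    (fun l => ole (omeet (tup (apx val p1 l) j) (tup (apx val p2 l) j)) (Some R)).
  + move=> l l' ll [i e]; exists i; apply: ole_botP; rewrite -e.
    exact: mono.
  + by move=> l l' ll; apply: ole_trans; apply: mono.
  + exact/mt/hl.
  + have [||i _ hi] := @antitone_exists Om J (indices p1 ++ indices p2)%list
      (fun i l => ole (omeet (tup (apx val p1 l) i) (tup (apx val p2 l) i)) (Some \bot)).
    * by move=> i l l' ll; apply: ole_trans; apply: mono.
    * move=> l; have [i ei] := hZ l.
      have : ole (tup (apx val (Mt p1 p2) l) i) (Some \bot).
        rewrite /tup /=; case: pselect => [?|n]; first exact: lexx.
        by case: n; exists i.
      have [hi|] := pselect (List.In i (indices p1 ++ indices p2)%list).
        by move=> _; exists i => //; rewrite ei; apply: lexx.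
      (* If [i] occurs in neither term, one of the two covers is zero at [i], hence at every index,
         and an index of [p1] serves instead. *)
      move=> hi _; have [i0 hi0] := indices_neq0 p1.
      have o1 : ~ List.In i (indices (apx val p1 l)).
        by rewrite indices_apx => hh; apply: hi; apply: List.in_or_app; left.
      have o2 : ~ List.In i (indices (apx val p2 l)).
        by rewrite indices_apx => hh; apply: hi; apply: List.in_or_app; right.
      exists i0; first by apply: List.in_or_app; left.
      move: ei; case: (up_outside (@fe Om) o1) => E1.
        case: (up_outside (@fe Om) o2) => E2; first by rewrite /tup E1 E2.
        by move=> _; rewrite /tup (up_zero i0 E2) omeet0; apply: lexx.
      move=> _; apply: ole_trans (omeet_lel _ _) _.
      by rewrite /tup (up_zero i0 E1); apply: lexx.
    * rewrite /=; case: pselect => [?|n]; first exact: le0x.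
      case: n; exists i; apply: ole_botP.
      by apply: (omeet_continuous (@tup_apx_mono p1 i) (@tup_apx_mono p2 i)) hi; auto.
  + rewrite /=; case: pselect => [?|?]; first exact: le0x.
    by apply: (omeet_continuous (@tup_apx_mono p1 j) (@tup_apx_mono p2 j)) hM; auto.
- apply/ojoinP; split; [apply: IH1|apply: IH2] => l; have /ojoinP[] := hl l; by [].
Qed.

Lemma le_factor p j x : ole (up val p j) (Some (val x)) -> eval h p <= h j x.
Proof.
case E: (up val p j) => [R|] //= lR; have [y ey ly] := upper_cover E.
apply: le_trans ly _; apply: hom_mono (h_hom j).1 _.
by apply: val_le; rewrite -ey.
Qed.

(** Whitman's argument, by induction on [p] and then on [q]. For a meet against a join there are
    five alternatives; each passes to smaller lists, so a single one holds for all
    approximations. *)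
Theorem word_problem p q : (forall l, ev q (apx val p l)) -> eval h p <= eval h q.
Proof.
have evA p' q' : antitone (fun l => ev q' (apx val p' l)).
  by move=> l l' ll; apply: ev_tle; apply: tle_apx.
elim: p q => [j x|p1 IH1 p2 IH2|p1 IH1 p2 IH2] q hq /=.
- have [y ey ly] := lower_cover q j; apply: le_trans ly.
  apply: hom_mono (h_hom j).1 _; apply: val_le; rewrite -ey.
  by apply: le_restricts => l; have /carL := hq l.
- elim: q hq => [j x|q1 IHq1 q2 IHq2|q1 IHq1 q2 IHq2] hq /=.
  + exact: (@le_factor (Mt p1 p2) j x (up_continuous hq)).
  + by rewrite lexI IHq1 ?IHq2 // => l; have [] := hq l.
  + pose Q j := jtr (ev q1) (ev q2) j.
    pose P1 l := ev q1 (apx val (Mt p1 p2) l).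
    pose P2 l := ev q2 (apx val (Mt p1 p2) l).
    pose P3 l := ev (Jn q1 q2) (apx val p1 l).
    pose P4 l := ev (Jn q1 q2) (apx val p2 l).
    (* Limiting [j] to indices of the term makes the choice finite, so that one factor can be kept
       for all [l]. *)
    pose P5 l := exists2 j, List.In j (indices (Mt p1 p2)) &
      ole (tup (apx val (Mt p1 p2) l) j) (Some (Q j)).
    have A1 : antitone P1 by apply: evA.
    have A2 : antitone P2 by apply: evA.
    have A3 : antitone P3 by apply: evA.
    have A4 : antitone P4 by apply: evA.
    have A5' j : antitone (fun l => ole (tup (apx val (Mt p1 p2) l) j) (Some (Q j))).
      by move=> l l' ll; apply: ole_trans; apply: tup_apx_mono.
    have A5 : antitone P5.
      by move=> l l' ll [j hj jj]; exists j => //; apply: A5' ll jj.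
    have Aor (P P' : list Om -> Prop) : antitone P -> antitone P' -> antitone (fun l => P l \/ P' l).
      by move=> a a' l l' ll [?|?]; [left; apply: a ll _|right; apply: a' ll _].
    have H l : P1 l \/ (P2 l \/ (P3 l \/ (P4 l \/ P5 l))).
      have := hq l; case=> [[g|g]|g|g|[j g]]; auto.
      do 4!right; have [i hi ii] := up_indices g.
      exists i; first by rewrite -(indices_apx val _ l).
      by case: ii => [->//|z]; rewrite /tup z; apply: le0x.
    have [g|{}H] := antitone_or A1 (Aor _ _ A2 (Aor _ _ A3 (Aor _ _ A4 A5))) H.
      exact: le_trans (IHq1 g) (leUl _ _).
    have [g|{}H] := antitone_or A2 (Aor _ _ A3 (Aor _ _ A4 A5)) H.
      exact: le_trans (IHq2 g) (leUr _ _).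
    have [g|{}H] := antitone_or A3 (Aor _ _ A4 A5) H.
      exact: le_trans (leIl _ _) (IH1 (Jn q1 q2) g).
    have [g|{}H] := antitone_or A4 A5 H.
      exact: le_trans (leIr _ _) (IH2 (Jn q1 q2) g).
    have [j _ g] := antitone_exists A5' H.
    have [y ey ly] := lower_cover (Jn q1 q2) j; apply: le_trans ly.
    by apply: (@le_factor (Mt p1 p2)); rewrite -ey; apply: up_continuous g.
- by rewrite leUx IH1 ?IH2 // => l; have /carJ[] := hq l.
Qed.

End WordProblem.

(** * Representing closed sets by equivalence relations *)

(** All points of Jonsson's construction are present from the start; the stages only change
    distances. A [Gadget] records its stage, its position on a path and the problem which that path
    solves. *)
Inductive point (T : Type) :=
| Base of T
| Gadget of nat & nat & point T & point T & T & T.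

Section Points.
Variables (Om J : Type) (j0 : J).
Notation T := (term J (fineq Om)).
Notation P := (point T).
Implicit Types (V : cset Om J) (x y z w u : P).

Let o : T := @bot Om J j0.

(** The axioms of a metric with joins for sums, where terms are compared through the closed sets
    that contain them. *)
Definition metric (d : P -> P -> T) := forall V,
  [/\ forall x, V (d x x), forall x y, V (d x y) -> V (d y x) &
      forall x y z, V (d x y) -> V (d y z) -> V (d x z)].

Section Step.
Variables (d : P -> P -> T) (n : nat).
Hypothesis dP : metric d.

(** This is d(x, y) <= a v b in the order tested by closed sets. *)
Definition valid x y (a b : T) := forall V, V a -> V b -> V (d x y).

(* At stage [n], each valid problem [Q = (x, y, a, b)] is solved by the points
   [z_k = Gadget n k x y a b] of a path x -a- z_0 -b- z_1 -a- z_2 -b- y; any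
   other point is kept. *)
Definition place z : option (P * P * T * T * nat) :=
  match z with
  | Gadget m k x y a b =>
      if pselect (m = n /\ valid x y a b) then Some (x, y, a, b, k) else None
  | _ => None
  end.

(** The end of the path on which [z] hangs: [z_0] and [z_1] on [x], the others on [y]. [cost] is the
    length of the path between the two. *)
Definition anchor z : P :=
  match place z with
  | Some (x, y, _, _, k) => if k is k'.+2 then y else x
  | None => z
  end.

Definition cost z : T :=
  match place z with
  | Some (_, _, a, b, k) =>
      match k with 0 => a | 1 => Jn a b | _ => b end
  | None => o
  end.

(** Distances along the path between [z_0] and [z_2]; positions above 2 are copies of [z_2] at
    distance [o]. *)
Definition inner (a b : T) (k k' : nat) : T :=
  match k, k' with
  | 0, 0 | 1, 1 => o
  | 0, 1 | 1, 0 => b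
  | 0, _ | _, 0 => Jn a b
  | 1, _ | _, 1 => a
  | _, _ => o
  end.

Definition outer z w := Jn (Jn (cost z) (cost w)) (d (anchor z) (anchor w)).

Definition step z w : T :=
  match place z, place w with
  | Some (x, y, a, b, k), Some (x', y', a', b', k') =>
      if pselect ((x, y, a, b) = (x', y', a', b')) then inner a b k k' else outer z w
  | _, _ => outer z w
  end.

Definition twins V z w := exists x y a b k k',
  [/\ place z = Some (x, y, a, b, k), place w = Some (x, y, a, b, k') &
      V (inner a b k k')].

Lemma outerP V z w :
  V (outer z w) <-> [/\ V (cost z), V (cost w) & V (d (anchor z) (anchor w))].
Proof. by rewrite /outer !carJ; split=> [[[? ?] ?]|[? ? ?]]. Qed.

Lemma place_valid z x y a b k : place z = Some (x, y, a, b, k) -> valid x y a b.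
Proof.
by case: z => //= m k' x' y' a' b'; case: pselect => //= e [<- <- <- <- _]; exact: e.2.
Qed.

Lemma inner_outer V z w x y a b k k' :
  place z = Some (x, y, a, b, k) -> place w = Some (x, y, a, b, k') ->
  V (outer z w) -> V (inner a b k k').
Proof.
move=> hz hw /outerP[]; rewrite /cost /anchor hz hw.
have vo : V o := car_bot j0 V.
by case: k k' {hz hw} => [|[|k]] [|[|k']] //=; rewrite ?carJ; tauto.
Qed.

(** Validity enters here. If [z] and [w] hang on different ends, their inner distance and the cost
    of [w] put both [a] and [b] into [V], hence also the distance of the two ends. *)
Lemma twins_outer V z w u : twins V z w -> V (outer w u) -> V (outer z u).
Proof.
move=> [x [y [a [b [k [k' [hz hw hV]]]]]]] /outerP[h1 h2 h3]; apply/outerP.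
have [dr ds dt] := dP V; have va := place_valid hz.
suff [h4 h5] : V (cost z) /\ V (d (anchor z) (anchor w)).
  by split=> //; apply: dt h5 h3.
move: h1 hV; rewrite /cost /anchor hz hw {hz hw h3}.
have both : V a -> V b -> V (d x y) /\ V (d y x).
  by move=> v1 v2; split; [|apply: ds]; apply: va.
have := dr x; have := dr y.
by case: k k' => [|[|k]] [|[|k']] //=; rewrite ?carJ; tauto.
Qed.

(** By [inner_outer] inner distances lie below outer ones, so the case distinction of [step] becomes
    a plain disjunction. *)
Lemma stepP V z w : V (step z w) <-> V (outer z w) \/ twins V z w.
Proof.
rewrite /step /twins; split.
- case hz: (place z) => [[[[[x y] a] b] k]|]; last by left.
  case hw: (place w) => [[[[[x' y'] a'] b'] k']|]; last by left.
  case: pselect => [e|?] /= h; last by left.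
  by case: e => ? ? ? ?; subst; right; exists x', y', a', b', k, k'.
- case hz: (place z) => [[[[[x1 y1] a1] b1] k1]|]; last first.
    by case=> // -[? [? [? [? [? [? []]]]]]].
  case hw: (place w) => [[[[[x' y'] a'] b'] k']|]; last first.
    by case=> // -[? [? [? [? [? [? []]]]]]].
  case: pselect => [e|ne] /=; last first.
    case=> // -[? [? [? [? [? [? [[? ? ? ? ?] [? ? ? ? ?] _]]]]]]].
    by case: ne; congruence.
  case: e => ? ? ? ?; subst; case=> [h|[? [? [? [? [? [? [[? ? ? ? ?] [? ? ? ? ?]]]]]]]]]; subst => //.
  exact: inner_outer hz hw h.
Qed.

Lemma inner_sym a b k k' : inner a b k k' = inner a b k' k.
Proof. by case: k k' => [|[|k]] [|[|k']]. Qed.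

Lemma step_metric : metric step.
Proof.
move=> V; have [dr ds dt] := dP V; have vo : V o := car_bot j0 V.
have osym z w : V (outer z w) -> V (outer w z).
  by move=> /outerP[? ? ?]; apply/outerP; split=> //; apply: ds.
have tsym z w : twins V z w -> twins V w z.
  move=> [x [y [a [b [k [k' [hz hw hV]]]]]]].
  by exists x, y, a, b, k', k; rewrite inner_sym.
split=> [z|z w /stepP h|z w u /stepP h1 /stepP h2]; apply/stepP.
- case hz: (place z) => [[[[[x y] a] b] k]|].
    by right; exists x, y, a, b, k, k; split=> //; case: k {hz} => [|[|k]].
  by left; apply/outerP; rewrite /cost /anchor hz; split.
- by case: h => h; [left; apply: (osym _ _ h)|right; apply: (tsym _ _ h)].
- case: h1 h2 => [o1|t1] [o2|t2].
  + left; move: o1 o2 => /outerP[h1 h2 h3] /outerP[h1' h2' h3'].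
    by apply/outerP; split=> //; apply: dt h3 h3'.
  + by left; apply: (osym _ _ (twins_outer (tsym _ _ t2) (osym _ _ o1))).
  + by left; apply: twins_outer t1 o2.
  + right; move: t1 t2 => [x [y [a [b [k [k' [hz hw hV]]]]]]].
    move=> [x1 [y1 [a1 [b1 [k1 [k1' [hw' hu hV']]]]]]].
    move: hw' hu hV'; rewrite hw => -[<- <- <- <- <-] hu hV'.
    exists x, y, a, b, k, k1'; split=> //; move: hV hV'.
    by case: (k) (k') (k1') => [|[|?]] [|[|?]] [|[|?]] //=; rewrite ?carJ; tauto.
Qed.

End Step.

Definition label x : T := if x is Base a then a else o.
(** A star: distinct points are joined through a centre at distance [label]. Gadgets have label zero
    here, a provisional value. *)
Definition dist0 x y : T :=
  if pselect (x = y) then o else Jn (label x) (label y).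

Fixpoint stage n : P -> P -> T :=
  if n is m.+1 then step (stage m) m else dist0.

Lemma stage_metric n : metric (stage n).
Proof.
elim: n => [|n IH] /=; last exact: step_metric.
move=> V; have vo : V o := car_bot j0 V.
have d0 x : dist0 x x = o by rewrite /dist0; case: pselect.
have dn x y : x <> y -> dist0 x y = Jn (label x) (label y).
  by rewrite /dist0; case: pselect.
split=> [x|x y|x y z]; first by rewrite d0.
- have [->//|n1] := pselect (x = y).
  by rewrite !dn //; [rewrite !carJ; tauto|move=> /esym].
- have [->//|n1] := pselect (x = y); have [->//|n2] := pselect (y = z).
  have [->|n3] := pselect (x = z); first by rewrite d0.
  by rewrite !dn // !carJ; tauto.
Qed.

Definition level x := if x is Gadget n _ _ _ _ _ then n.+1 else 0.

Lemma place_level d n x : (level x <= n)%N -> place d n x = None.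
Proof.
by case: x => //= m k x y a b; case: pselect => //= e; rewrite e.1 ltnn.
Qed.

(** Stage [m] moves only gadgets of level [m.+1], so distances between points of level at most [n]
    are final from stage [n] on. *)
Lemma stage_stable V x y n m : (level x <= n)%N -> (level y <= n)%N -> (n <= m)%N ->
  V (stage m x y) <-> V (stage n x y).
Proof.
have vo : V o := car_bot j0 V.
move=> hx hy; elim: m => [|m IH]; first by rewrite leqn0 => /eqP->.
rewrite leq_eqVlt => /orP[/eqP->//|]; rewrite ltnS => nm; rewrite -(IH nm) /=.
have hx' := place_level (stage m) (leq_trans hx nm).
have hy' := place_level (stage m) (leq_trans hy nm).
rewrite stepP outerP /twins /cost /anchor hx' hy'.
split=> [[[]//|[? [? [? [? [? [? []]]]]]]]|h] //.
by left.
Qed.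

Definition dist x y := stage (maxn (level x) (level y)) x y.

Lemma distE V x y n : (level x <= n)%N -> (level y <= n)%N ->
  V (dist x y) <-> V (stage n x y).
Proof.
move=> hx hy; rewrite /dist; apply: iff_sym; apply: stage_stable.
- exact: leq_maxl.
- exact: leq_maxr.
- by rewrite geq_max hx.
Qed.

Lemma dist_metric : metric dist.
Proof.
move=> V; split=> [x|x y|x y z].
- by have [h _ _] := stage_metric (maxn (level x) (level x)) V; apply: h.
- by rewrite /dist maxnC; have [_ h _] := stage_metric (maxn (level y) (level x)) V; apply: h.
- pose n := maxn (level x) (maxn (level y) (level z)).
  have hx : (level x <= n)%N by apply: leq_maxl.
  have hy : (level y <= n)%N by rewrite !leq_max leqnn orbT.
  have hz : (level z <= n)%N by rewrite !leq_max leqnn !orbT.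
  rewrite !(@distE V _ _ n) //; have [_ _ h] := stage_metric n V; exact: h.
Qed.

Definition ball V x y := V (dist x y).

Lemma ball_equiv V : is_equivalence (ball V).
Proof. exact: dist_metric. Qed.

Definition rep V : equivrel P := EqRel (ball_equiv V).

Lemma rep_le V1 V2 : rep V1 <= rep V2 <-> (forall s, V1 s -> V2 s).
Proof.
split=> [/erel_leP h s|h]; last by apply/erel_leP => x y; apply: h.
(* The distance from [Base s] to [Base o] is [s] up to a joined zero, so [V] can be recovered from
   [rep V]. *)
have dE V : V (dist (Base s) (Base o)) <-> V s.
  rewrite /dist /= /dist0; have vo : V o := car_bot j0 V.
  by case: pselect => [e|?] /=; [case: e => ->|rewrite carJ; tauto].
by move=> /dE /h /dE.
Qed.

Lemma rep_meet V1 V2 : rep (cmeet V1 V2) = rep V1 `&` rep V2.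
Proof. by apply: eqrel_ext. Qed.

Lemma gadget_path x y a b : (forall V, V a -> V b -> V (dist x y)) ->
  exists z0 z1 z2, forall V,
    [/\ V a -> V (dist x z0), V b -> V (dist z0 z1),
        V a -> V (dist z1 z2) & V b -> V (dist z2 y)].
Proof.
(* At this stage the distance of [x] and [y] is final, so [hd] makes the problem valid exactly where
   its gadgets are placed. *)
move=> hd; pose n := maxn (level x) (level y); pose g k := Gadget n k x y a b.
have hx : (level x <= n)%N by apply: leq_maxl.
have hy : (level y <= n)%N by apply: leq_maxr.
have hg k : place (stage n) n (g k) = Some (x, y, a, b, k).
  by rewrite /=; case: pselect => // -[].
have lg k : (level (g k) <= n.+1)%N by [].
exists (g 0), (g 1), (g 2) => V.
have vo : V o := car_bot j0 V; have [dr _ _] := stage_metric n V.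
split=> v; rewrite (@distE V _ _ n.+1) //=; try exact: leq_trans (leqnSn n);
  rewrite stepP.
- left; apply/outerP; rewrite /cost /anchor hg (place_level _ hx).
  by split.
- by right; exists x, y, a, b, 0, 1.
- by right; exists x, y, a, b, 1, 2.
- left; apply/outerP; rewrite /cost /anchor hg (place_level _ hy).
  by split.
Qed.

(** A distance in the join is forced by some [a] in [V1] and [b] in [V2]; the gadget path then links
    the points by steps alternating between [rep V1] and [rep V2]. *)
Lemma rep_join V1 V2 : rep (cjoin V1 V2) = rep V1 `|` rep V2.
Proof.
apply/eqP; rewrite eq_le leUx; apply/and3P; split.
- apply/erel_leP => x y h; apply/erel_joinP => E /erel_leP h1 /erel_leP h2.
  have [a [b [va vb hab]]] := cjoin_finitary j0 h.
  have [z0 [z1 [z2 hz]]] := gadget_path hab.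
  have [p1 _ p3 _] := hz V1; have [_ p2 _ p4] := hz V2.
  apply: erel_trans (h1 _ _ (p1 va)) _; apply: erel_trans (h2 _ _ (p2 vb)) _.
  exact: erel_trans (h1 _ _ (p3 va)) (h2 _ _ (p4 vb)).
- by apply/rep_le; apply: cjoinl.
- by apply/rep_le; apply: cjoinr.
Qed.

Lemma rep_fset_meet j (R S : equivrel Om) :
  rep (fset j (R `&` S)) = rep (fset j R) `&` rep (fset j S).
Proof.
apply: eqrel_ext => x y; split.
  by move=> h; split; apply: ole_trans h _; [apply: leIl|apply: leIr].
by move=> [h1 h2]; apply: (@le_omeet _ (Some R) (Some S)).
Qed.

Lemma rep_fset_join j (R S : equivrel Om) :
  rep (fset j (R `|` S)) = rep (fset j R) `|` rep (fset j S).
Proof.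
rewrite -rep_join; apply/eqP; rewrite eq_le; apply/andP; split; apply/rep_le => s.
- move=> h; apply: (@carU _ _ _ j); apply: ole_trans h _.
  by rewrite /= /jtr /= /ftr; case: pselect => // _; apply: lexx.
- by apply: cjoin_min => t h; apply: ole_trans h _; [apply: leUl|apply: leUr].
Qed.

Lemma rep_fset_bot i j : rep (fset i \bot) = rep (fset j \bot).
Proof.
apply: eqrel_ext => x y.
split=> /ole_botP h; rewrite /ball /= /fcar /tup.
  by rewrite (up_zero j h) /=.
by rewrite (up_zero i h) /=.
Qed.

End Points.

(** [rep] carries meets and joins of closed sets to those of equivalence relations, so an inequality
    of values is an inclusion of closed sets and the word problem applies. The common zero [D] may
    exceed equality. *)
Theorem factors_reflect (Om J : Type) (j0 : J) (d : Order.disp_t) (L : bLatticeType d)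
    (val : L -> equivrel Om) : lattice0_embedding val ->
  exists (G : J -> L -> equivrel (point (term J (fineq Om)))) D,
  [/\ forall j, lattice_hom (G j), forall j, G j \bot = D &
   forall dM (M : bLatticeType dM) (h : J -> L -> M), (forall j, lattice0_hom (h j)) ->
     forall p q, eval G p <= eval G q -> eval h p <= eval h q].
Proof.
move=> ve; exists (fun j x => rep j0 (fset j (val x))), (rep j0 (fset j0 \bot)).
have [[vhom v0] _] := ve.
split=> [j x y|j|dM M h hh p q].
- by have [-> ->] := vhom x y; rewrite rep_fset_meet rep_fset_join.
- by rewrite v0; apply: rep_fset_bot.
- have evE r : eval (fun j x => rep j0 (fset j (val x))) r = rep j0 (ev val r).
    by elim: r => //= r1 -> r2 ->; rewrite ?rep_meet ?rep_join.
  rewrite !evE => /rep_le le; apply: (word_problem ve hh) => l.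
  by apply: le; apply: ev_apx.
Qed.

(** * Power set many factors *)

Section Injections.
Variable Om : Type.
Hypothesis Om_inf : infinite_set [set: Om].

Lemma injects_trans A B C : injects A B -> injects B C -> injects A C.
Proof. by move=> [f fi] [g gi]; exists (g \o f); apply: inj_comp. Qed.

Lemma injects_pair A B : injects A Om -> injects B Om -> injects (A * B) Om.
Proof.
move=> [f fi] [g gi]; apply: injects_trans (infinite_square Om_inf).
by exists (fun u => (f u.1, g u.2)) => -[a b] [a' b'] [/fi-> /gi->].
Qed.

Lemma injects_list A : injects A Om -> injects (list A) Om.
Proof.
move=> [f fi]; have [nu nui] := injects_nat Om_inf; have [pi pii] := infinite_square Om_inf.
pose g := fix g l := match l with
  | nil => pi (nu 0, nu 0) | a :: l => pi (nu 1, pi (f a, g l)) end.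
exists g; elim=> [|a l IH] [|b m] //= /pii [].
- by move/nui.
- by move/nui.
- by move=> /pii [/fi-> /IH->].
Qed.

Lemma injects_term I E : injects I Om -> injects E Om -> injects (term I E) Om.
Proof.
move=> [f fi] [g gi]; have [nu nui] := injects_nat Om_inf; have [pi pii] := infinite_square Om_inf.
pose c := fix c p := match p with
  | Leaf i e => pi (nu 0, pi (f i, g e))
  | Mt s t => pi (nu 1, pi (c s, c t))
  | Jn s t => pi (nu 2, pi (c s, c t)) end.
exists c; elim=> [i e|s IHs t IHt|s IHs t IHt] [i' e'|s' t'|s' t'] //= /pii [];
  try (by move/nui); move=> /pii [].
- by move=> /fi-> /gi->.
- by move=> /IHs-> /IHt->.
- by move=> /IHs-> /IHt->.
Qed.

Lemma injects_point A : injects A Om -> injects (point A) Om.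
Proof.
move=> [f fi]; have [nu nui] := injects_nat Om_inf; have [pi pii] := infinite_square Om_inf.
pose c := fix c p := match p with
  | Base a => pi (nu 0, f a)
  | Gadget n k x y a b =>
      pi (nu 1, pi (pi (nu n, nu k), pi (pi (c x, c y), pi (f a, f b)))) end.
exists c; elim=> [a|n k x IHx y IHy a b] [a'|n' k' x' y' a' b'] //= /pii [];
  try (by move/nui).
- by move/fi->.
- move=> /pii [/pii [/nui-> /nui->] /pii [/pii [/IHx-> /IHy->]]].
  by move=> /pii [/fi-> /fi->].
Qed.

(** A relation of finite support is coded by a finite list of generating pairs. *)
Lemma injects_fineq : injects (fineq Om) Om.
Proof.
have iOm : injects Om Om by exists id.
apply: injects_trans (injects_list (injects_pair iOm iOm)).
have /choice[f fP] := fun k : fineq Om => finite_support_gen (feP k).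
exists f => -[R hR] [S hS] e.
have [h1 h2] := fP (FinEq hR); have [h3 h4] := fP (FinEq hS).
have eRS : R = S.
  apply/eqP; rewrite eq_le; apply/andP; split.
    by apply: h2; rewrite e.
  by apply: h4; rewrite -e.
by subst S; rewrite (Prop_irrelevance hR hS).
Qed.

Lemma injects_bits : injects (list bool) Om.
Proof.
apply: injects_list; apply: injects_trans (injects_nat Om_inf).
by exists nat_of_bool => -[] [].
Qed.

End Injections.

(** * Sums of equivalence relations over a quotient *)

Section Glue.
Variables (Om X Y : Type) (D : equivrel X) (e : X * Y -> Om).
Hypothesis eP : forall x y l m, e (x, l) = e (y, m) <-> l = m /\ D x y.
Implicit Types R S : Y -> equivrel X.

(** The disjoint sum of the [R l] on copies of X / D, carried to [Om] by [e] and trivial elsewhere.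
    Joining with [D] makes it an equivalence for every [R]. *)
Definition glue_rel R u v :=
  u = v \/ exists l x y, [/\ u = e (x, l), v = e (y, l) & (R l `|` D) x y].

Lemma glue_equiv R : is_equivalence (glue_rel R).
Proof.
split=> [u|u v [->|[l [x [y [-> -> h]]]]]|u v w]; try by left.
- by right; exists l, y, x; split=> //; apply: erel_sym.
- move=> [->//|[l [x [y [-> -> h]]]]] [<-|[m [y' [z [/eP[<- dy] -> h']]]]].
    by right; exists l, x, y.
  right; exists l, x, z; split=> //; apply: erel_trans h (erel_trans _ h').
  have /erel_leP : D <= R l `|` D by apply: leUr.
  exact.
Qed.

Definition glue R : equivrel Om := EqRel (glue_equiv R).

Lemma glueP R l x y : D <= R l -> glue R (e (x, l)) (e (y, l)) <-> R l x y.
Proof.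
move=> DR; have /erel_leP DR' := DR.
split=> [[/eP[_ /DR']//|[m [x' [y' [/eP[<- dx] /eP[_ dy] h]]]]]|h].
  move: h; rewrite (join_idPl DR) => h.
  exact: erel_trans (DR' _ _ dx) (erel_trans h (erel_sym (DR' _ _ dy))).
by right; exists l, x, y; rewrite (join_idPl DR).
Qed.

Lemma glue_le R S : (forall l, D <= R l) -> (forall l, D <= S l) ->
  glue R <= glue S <-> (forall l, R l <= S l).
Proof.
move=> DR DS; split=> [/erel_leP h l|h]; apply/erel_leP.
  by move=> x y /(glueP _ _ (DR l)) /h /(glueP _ _ (DS l)).
move=> u v [->|[l [x [y [-> -> hxy]]]]]; first exact: erel_refl.
by apply/(glueP _ _ (DS l)); move: hxy; rewrite (join_idPl (DR l)); have /erel_leP := h l; apply.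
Qed.

Lemma glue_meet R S : (forall l, D <= R l) -> (forall l, D <= S l) ->
  glue (fun l => R l `&` S l) = glue R `&` glue S.
Proof.
move=> DR DS; have DI l : D <= R l `&` S l by rewrite lexI DR DS.
apply/eqP; rewrite eq_le lexI -andbA; apply/and3P; split.
- by apply: (glue_le DI DR).2 => l; apply: leIl.
- by apply: (glue_le DI DS).2 => l; apply: leIr.
- apply/erel_leP => u v [h1 h2]; case: h1 => [->|[l [x [y [eu ev h]]]]].
    exact: erel_refl.
  move: h h2; rewrite eu ev (join_idPl (DR l)) => h /(glueP _ _ (DS l)) h2.
  by apply/(glueP _ _ (DI l)).
Qed.

Lemma pullback_equiv (E : equivrel Om) l :
  is_equivalence (fun x y => E (e (x, l)) (e (y, l))).
Proof.
split=> [x|x y|x y z]; [exact: erel_refl|exact: erel_sym|exact: erel_trans].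
Qed.

Lemma glue_join R S : (forall l, D <= R l) -> (forall l, D <= S l) ->
  glue (fun l => R l `|` S l) = glue R `|` glue S.
Proof.
move=> DR DS; have DU l : D <= R l `|` S l by apply: le_trans (DR l) (leUl _ _).
apply/eqP; rewrite eq_le leUx; apply/and3P; split.
- apply/erel_leP => u v [->|[l [x [y [-> -> h]]]]]; first exact: erel_refl.
  move: h; rewrite (join_idPl (DU l)) => h.
  apply/erel_joinP => E /erel_leP RE /erel_leP SE.
  (* An upper bound [E] of both sums is tested on one component by pulling it back along [e]. *)
  move/erel_joinP: h => /(_ (EqRel (pullback_equiv E l))); apply.
    by apply/erel_leP => a b /(glueP _ _ (DR l)) /RE.
  by apply/erel_leP => a b /(glueP _ _ (DS l)) /SE.
- by apply: (glue_le DR DU).2 => l; apply: leUl.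
- by apply: (glue_le DS DU).2 => l; apply: leUr.
Qed.

Lemma glue_bot : glue (fun _ => D) = \bot.
Proof.
apply/eqP; rewrite -lex0; apply/erel_leP => u v [->//|[l [x [y [-> -> h]]]]].
by apply/eP; split=> //; move: h; rewrite joinxx.
Qed.

End Glue.

(** The representative is chosen from the predicate [D x], which related points share by
    extensionality. *)
Lemma quotient_injection Om X (D : equivrel X) : X -> injects X Om ->
  exists c : X -> Om, forall x y, c x = c y <-> D x y.
Proof.
move=> x0 [f fi].
have /choice[g gP] : forall A : X -> Prop, exists y, (exists z, A z) -> A y.
  move=> A; have [[z Az]|nA] := pselect (exists z, A z); first by exists z.
  by exists x0.
have gD x : D x (g (D x)) by apply: gP; exists x; apply: erel_refl.
exists (fun x => f (g (D x))) => x y; split=> [/fi h|h].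
  by apply: erel_trans (gD x) _; rewrite h; apply: erel_sym; apply: gD.
congr (f (g _)); apply: funext => z; apply: propext.
by split; apply: erel_trans => //; apply: erel_sym.
Qed.

Fixpoint reindex I I' E E' (f : I -> I') (g : E -> E') (p : term I E) : term I' E' :=
  match p with
  | Leaf i e => Leaf (f i) (g e)
  | Mt s t => Mt (reindex f g s) (reindex f g t)
  | Jn s t => Jn (reindex f g s) (reindex f g t)
  end.

Section Separation.
Variable Om : Type.

Definition bits (l : list Om) (i : classical_sets.set Om) : list bool :=
  List.map (fun x => `[< i x >]) l.

(** One point of the symmetric difference is put into [l] for each pair of distinct indices in
    [s]. *)
Lemma bits_separate (s : list (classical_sets.set Om)) :
  exists l, forall i j, List.In i s -> List.In j s -> bits l i = bits l j -> i = j.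
Proof.
suff [l hl] : exists l, forall u, List.In u (List.list_prod s s) ->
    bits l u.1 = bits l u.2 -> u.1 = u.2.
  by exists l => i j hi hj; apply: (hl (i, j)); apply: List.in_prod.
elim: (List.list_prod s s) => [|[i j] r [l IH]]; first by exists nil.
have [->|nij] := pselect (i = j).
  by exists l => u [<-//|hu]; apply: IH.
have [x hx] : exists x, `[< i x >] <> `[< j x >].
  apply: contrapT => /forallNP h; apply: nij; apply: funext => x; apply: propext.
  by have /contrapT hx := h x; split=> /asboolP; [rewrite hx|rewrite -hx] => /asboolP.
exists (x :: l) => u [<-|hu] /= [e1 e2]; first by case: hx.
exact: IH.
Qed.

Lemma bits_retract (s : list (classical_sets.set Om)) :
  exists l (g : list bool -> classical_sets.set Om),
    forall i, List.In i s -> g (bits l i) = i.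
Proof.
have [l hl] := bits_separate s; exists l.
have /choice[g gP] : forall b, exists i0, forall i, List.In i s -> bits l i = b -> i0 = i.
  move=> b; have [[i [hi bi]]|n] := pselect (exists i, List.In i s /\ bits l i = b).
    by exists i => j hj bj; apply: hl => //; rewrite bi.
  by exists classical_sets.setT => i hi bi; case: n; exists i.
by exists g => i hi; apply: gP.
Qed.

End Separation.

Lemma eval_reindex I I' E d (M : latticeType d) (h : I -> E -> M) (h' : I' -> E -> M)
    (f : I -> I') (p : term I E) :
  (forall i, List.In i (indices p) -> h' (f i) = h i) ->
  eval h' (reindex f id p) = eval h p.
Proof.
elim: p => [i x|s IHs t IHt|s IHs t IHt] /= hf.
- by rewrite hf //; left.
- rewrite IHs ?IHt // => i hi; apply: hf; apply: List.in_or_app; auto.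
- rewrite IHs ?IHt // => i hi; apply: hf; apply: List.in_or_app; auto.
Qed.

Theorem power_reflect (Om : Type) (d : Order.disp_t) (L : bLatticeType d)
    (val : L -> equivrel Om) : infinite_set [set: Om] -> lattice0_embedding val ->
  exists F : classical_sets.set Om -> L -> equivrel Om,
  (forall i, lattice0_hom (F i)) /\
  forall dM (M : bLatticeType dM) (h : classical_sets.set Om -> L -> M),
    (forall i, lattice0_hom (h i)) ->
    forall p q, eval F p <= eval F q -> eval h p <= eval h q.
Proof.
move=> Om_inf ve.
have [G [D [Ghom G0 Gle]]] := factors_reflect (nil : list bool) ve.
pose X := point (term (list bool) (fineq Om)).
have iX : injects X Om.
  apply: (injects_point Om_inf); apply: (injects_term Om_inf).
    exact: injects_bits.
  exact: injects_fineq.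
have iOm : injects Om Om by exists id.
have [c cP] := quotient_injection D (Base (bot _ nil) : X) iX.
have [pi pii] := infinite_square Om_inf.
have [k ki] := injects_list Om_inf iOm.
pose e (u : X * list Om) := pi (c u.1, k u.2).
have eP x y l m : e (x, l) = e (y, m) <-> l = m /\ D x y.
  by rewrite /e; split=> [/pii [/cP ? /ki ?]|[-> /cP ->]].
have DG p : D <= eval G p.
  elim: p => [j x|s IHs t IHt|s IHs t IHt] /=.
  - by rewrite -(G0 j); apply: hom_mono (Ghom j) (le0x _).
  - by rewrite lexI IHs.
  - by apply: le_trans IHs (leUl _ _).
have DGl j x : D <= G j x := DG (Leaf j x).
(* On component [l] the index [i] acts as the factor named by its trace on [l]. Passing to the
   quotient by [D] turns the common zero into equality. *)
pose F i x := glue eP (fun l => G (bits l i) x).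
have FE p : eval F p = glue eP (fun l => eval G (reindex (bits l) id p)).
  elim: p => [//|s IHs t IHt|s IHs t IHt] /=.
  - by rewrite IHs IHt glue_meet.
  - by rewrite IHs IHt glue_join.
exists F; split=> [i|dM M h hh p q].
  split=> [x y|]; rewrite /F.
    have hI l := (Ghom (bits l i) x y).1; have hU l := (Ghom (bits l i) x y).2.
    by rewrite (funext hI) (funext hU) glue_meet ?glue_join.
  by rewrite (funext (fun l => G0 (bits l i))) glue_bot.
rewrite !FE glue_le // => le.
(* On a component that separates all indices of [p] and [q], the inequality is one between distinct
   factors, and [g] restores the original indices. *)
have [l [g gP]] := bits_retract (indices p ++ indices q)%list.
have := Gle _ M (fun j => h (g j)) (fun j => hh _) _ _ (le l).
rewrite !(@eval_reindex _ _ _ _ _ h) // => i hi; rewrite gP //; apply: List.in_or_app; auto.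
Qed.

(** * Coproducts *)

Definition withbot (A : Type) : Type := option A.

Section WithBot.
Variables (d : Order.disp_t) (A : latticeType d).
Implicit Types a b c : withbot A.

HB.instance Definition _ := gen_eqMixin (withbot A).
HB.instance Definition _ := gen_choiceMixin (withbot A).

Definition wle a b : bool :=
  match a, b with None, _ => true | Some x, Some y => x <= y | Some _, None => false end.
Definition wmeet a b : withbot A :=
  match a, b with Some x, Some y => Some (x `&` y) | _, _ => None end.
Definition wjoin a b : withbot A :=
  match a, b with Some x, Some y => Some (x `|` y) | None, _ => b | _, None => a end.

Lemma wle_refl : reflexive wle. Proof. by case=> //= x; apply: lexx. Qed.
Lemma wle_anti : antisymmetric wle.
Proof. by move=> [x|] [y|] //= /le_anti->. Qed.
Lemma wle_trans : transitive wle.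
Proof. by move=> [x|] [y|] [z|] //=; apply: le_trans. Qed.

HB.instance Definition _ :=
  Order.Le_isPOrder.Build d (withbot A) wle_refl wle_anti wle_trans.

Lemma wlexI a b c : (a <= wmeet b c) = (a <= b) && (a <= c).
Proof. by case: a b c => [x|] [y|] [z|]; rewrite /Order.le /= ?lexI ?andbF. Qed.
Lemma wleUx a b c : (wjoin a b <= c) = (a <= c) && (b <= c).
Proof. by case: a b c => [x|] [y|] [z|]; rewrite /Order.le /= ?leUx ?andbT. Qed.

HB.instance Definition _ :=
  Order.POrder_isMeetSemilattice.Build d (withbot A) wlexI.
HB.instance Definition _ :=
  Order.POrder_isJoinSemilattice.Build d (withbot A) wleUx.

Lemma wle0x a : (None : withbot A) <= a. Proof. by []. Qed.
HB.instance Definition _ := Order.hasBottom.Build d (withbot A) wle0x.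

End WithBot.

(** * Generation of coproducts by their factors *)

Section Span.
Variables (d : Order.disp_t) (B : bLatticeType d) (I E : Type) (iota : I -> E -> B).

Definition spanned (b : B) := b = \bot \/ exists p, eval iota p = b.

Record span := Span { span_val : B; spanP : spanned span_val }.
Implicit Types s t u : span.

Lemma span_inj : injective span_val.
Proof. by move=> [x hx] [y hy] /= e; subst y; rewrite (Prop_irrelevance hx hy). Qed.

HB.instance Definition _ := gen_eqMixin span.
HB.instance Definition _ := gen_choiceMixin span.

Definition sle s t : bool := span_val s <= span_val t.
Lemma sle_refl : reflexive sle. Proof. by move=> s; apply: lexx. Qed.
Lemma sle_anti : antisymmetric sle. Proof. by move=> s t /le_anti/span_inj. Qed.
Lemma sle_trans : transitive sle. Proof. by move=> s t u; apply: le_trans. Qed.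

HB.instance Definition _ := Order.Le_isPOrder.Build d span sle_refl sle_anti sle_trans.

Lemma spanned_meet s t : spanned (span_val s `&` span_val t).
Proof.
case: (spanP s) (spanP t) => [->|[p <-]] [->|[q <-]]; rewrite ?meet0x ?meetx0; try by left.
by right; exists (Mt p q).
Qed.
Lemma spanned_join s t : spanned (span_val s `|` span_val t).
Proof.
case: (spanP s) (spanP t) => [->|[p <-]] [->|[q <-]]; rewrite ?join0x ?joinx0; try by left.
- by right; exists q.
- by right; exists p.
- by right; exists (Jn p q).
Qed.
Definition smeet s t := Span (spanned_meet s t).
Definition sjoin s t := Span (spanned_join s t).

Lemma slexI s t u : (s <= smeet t u) = (s <= t) && (s <= u).
Proof. exact: lexI. Qed.
Lemma sleUx s t u : (sjoin s t <= u) = (s <= u) && (t <= u).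
Proof. exact: leUx. Qed.

HB.instance Definition _ := Order.POrder_isMeetSemilattice.Build d span slexI.
HB.instance Definition _ := Order.POrder_isJoinSemilattice.Build d span sleUx.

Lemma sle0x s : Span (or_introl erefl) <= s. Proof. exact: le0x. Qed.
HB.instance Definition _ := Order.hasBottom.Build d span sle0x.

Lemma spanned_gen i x : spanned (iota i x). Proof. by right; exists (Leaf i x). Qed.
Definition sgen i x := Span (spanned_gen i x).

End Span.

Lemma eval_hom I E d1 d2 (M : latticeType d1) (N : latticeType d2) (g : M -> N)
    (h : I -> E -> M) (h' : I -> E -> N) (p : term I E) :
  lattice_hom g -> (forall i x, g (h i x) = h' i x) -> g (eval h p) = eval h' p.
Proof.
move=> gh e; elim: p => [i x|s IHs t IHt|s IHs t IHt] /=; first exact: e.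
  by rewrite (gh _ _).1 IHs IHt.
by rewrite (gh _ _).2 IHs IHt.
Qed.

(** The universal property maps [C] into the span of the factors; by uniqueness, following this map
    with the inclusion gives the identity. An index is needed to write zero as a term. *)
Lemma coproduct0_span I d dC (L : bLatticeType d) (C : bLatticeType dC)
    (iota : I -> L -> C) : lattice0_coproduct iota -> inhabited I ->
  forall c, exists p, eval iota p = c.
Proof.
move=> [hi univ] [i0] c.
have sh i : lattice0_hom (@sgen _ C _ _ iota i).
  split=> [x y|]; last by apply: span_inj; apply: (hi i).2.
  by split; apply: span_inj; [apply: ((hi i).1 x y).1|apply: ((hi i).1 x y).2].
have [k [[[kh k0] ks] _]] := univ _ _ _ sh.
have [g [_ gu]] := univ _ _ _ hi.
have e1 : g = id by apply: gu; split=> //; split.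
have e2 : g = @span_val _ C _ _ iota \o k.
  apply: gu; split=> [|i x]; last by rewrite /= ks.
  by split=> [x y|]; rewrite /= ?k0 // (kh x y).1 (kh x y).2.
have ec : c = span_val (k c) by rewrite -[LHS]/(id c) -e1 e2.
rewrite ec; case: (spanP (k c)) => [->|//].
by exists (Leaf i0 \bot); apply: (hi i0).2.
Qed.

Lemma withbot_hom d dC (L : latticeType d) (C : latticeType dC) (f : L -> C) :
  lattice_hom f -> lattice0_hom (omap f : withbot L -> withbot C).
Proof.
move=> fh; split=> // -[x|] [y|] //; split=> //=.
- by apply: (congr1 Some); apply: (fh x y).1.
- by apply: (congr1 Some); apply: (fh x y).2.
Qed.

(** The span is formed in [withbot C], which supplies its zero; elements coming from [C] are never
    the new zero, so they are values of terms. *)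
Lemma coproduct_span I d dC (L : latticeType d) (C : latticeType dC)
    (iota : I -> L -> C) : lattice_coproduct iota ->
  forall c, exists p, eval iota p = c.
Proof.
move=> [hi univ] c.
pose iota' i x : withbot C := Some (iota i x).
have ih i : lattice_hom (iota' i).
  move=> x y; rewrite /iota'; split; congr Some; [exact: (hi i x y).1|exact: (hi i x y).2].
have sh i : lattice_hom (@sgen _ (withbot C) _ _ iota' i).
  by move=> x y; split; apply: span_inj; [apply: (ih i x y).1|apply: (ih i x y).2].
have [k [[kh ks] _]] := univ _ _ _ sh.
have [g [_ gu]] := univ _ _ _ ih.
have e1 : g = (fun c => Some c) by apply: gu; split.
have e2 : g = @span_val _ (withbot C) _ _ iota' \o k.
  apply: gu; split=> [|i x]; last by rewrite /= ks.
  by move=> x y; rewrite /= (kh x y).1 (kh x y).2.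
have ec : Some c = span_val (k c) by rewrite -[LHS]/((fun c => Some c) c) -e1 e2.
case: (spanP (k c)) => [e|[p e]]; first by rewrite -ec in e.
exists p; apply: Some_inj; rewrite ec -e.
exact: (@eval_hom _ _ _ _ C (withbot C) Some iota iota').
Qed.

(** Put [R] on one copy of [Om] and the full relation on another. The image is never equality, which
    remains free to represent the new zero. *)
Lemma embed_withbot (Om : Type) : infinite_set [set: Om] ->
  exists val : withbot (equivrel Om) -> equivrel Om, lattice0_embedding val.
Proof.
move=> Om_inf; have [nu nui] := injects_nat Om_inf.
have iOm : injects Om Om by exists id.
have ib : injects bool Om.
  by apply: injects_trans (injects_nat Om_inf); exists nat_of_bool => -[] [].
have [e ei] := injects_pair Om_inf iOm ib.
have eP x y l m : e (x, l) = e (y, m) <-> l = m /\ (\bot : equivrel Om) x y.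
  by split=> [/ei [-> ->]|[-> ->]].
pose W (R : equivrel Om) (b : bool) := if b then R else \top.
pose f (R : equivrel Om) := glue eP (W R).
have f_le R S : f R <= f S -> R <= S.
  by rewrite /f glue_le; [move=> /(_ true)| |] => // l; apply: le0x.
have f_neq0 R : f R <> \bot.
  rewrite -(glue_bot eP) => h; have : f R <= glue eP (fun=> \bot) by rewrite h.
  rewrite /f glue_le; try by move=> l; apply: le0x.
  by move=> /(_ false) /erel_leP /(_ (nu 0) (nu 1) I) /nui.
have fI R S : f (R `&` S) = f R `&` f S.
  rewrite /f -glue_meet; try by move=> l; apply: le0x.
  by congr glue; apply: funext => -[] //=; rewrite meetxx.
have fU R S : f (R `|` S) = f R `|` f S.
  rewrite /f -glue_join; try by move=> l; apply: le0x.
  by congr glue; apply: funext => -[] //=; rewrite joinxx.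
exists (fun w => if w is Some R then f R else \bot); split.
  split=> // -[R|] [S|]; split; rewrite ?meet0x ?meetx0 ?join0x ?joinx0 //;
    [exact: fI|exact: fU].
move=> [R|] [S|] // h; last by case: (f_neq0 S); rewrite -h.
  have {}h : f R = f S := h.
  by congr Some; apply/eqP; rewrite eq_le; apply/andP; split; apply: (f_le _ _ _);
    rewrite h; apply: lexx.
by case: (f_neq0 R).
Qed.

(** Every element of [C] is the value of a term, so injectivity of the map induced by [F] is the
    reflection property for the family [iota] itself. *)
Lemma coproduct0_embed (Om : Type) : infinite_set [set: Om] ->
  forall dC (C : bLatticeType dC) (iota : classical_sets.set Om -> equivrel Om -> C),
    lattice0_coproduct iota -> exists f : C -> equivrel Om, lattice0_embedding f.
Proof.
move=> Om_inf dC C iota ci.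
have ve : lattice0_embedding (@id (equivrel Om)) by split=> //; split.
have [F [Fh Fle]] := power_reflect Om_inf ve.
have [f [[fh fi] _]] := ci.2 _ _ F Fh.
exists f; split=> // c c'.
have [p <-] := coproduct0_span ci (inhabits classical_sets.setT) c.
have [q <-] := coproduct0_span ci (inhabits classical_sets.setT) c'.
rewrite !(eval_hom _ fh.1 fi) => e; apply/eqP; rewrite eq_le.
by rewrite !(Fle _ C iota ci.1) ?e //; apply: lexx.
Qed.

Lemma coproduct_embed (Om : Type) : infinite_set [set: Om] ->
  forall dC (C : latticeType dC) (iota : classical_sets.set Om -> equivrel Om -> C),
    lattice_coproduct iota -> exists f : C -> equivrel Om, lattice_embedding f.
Proof.
move=> Om_inf dC C iota ci.
have [val ve] := embed_withbot Om_inf.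
have [F [Fh Fle]] := power_reflect Om_inf ve.
have Fh' i : lattice_hom (fun R => F i (Some R)).
  by move=> R S; have [/(_ (Some R) (Some S)) [<- <-] _] := Fh i.
have [f [[fh fi] _]] := ci.2 _ _ _ Fh'.
exists f; split=> // c c'.
have [p <-] := coproduct_span ci c.
have [q <-] := coproduct_span ci c'.
pose lift := reindex (@id (classical_sets.set Om)) (fun R : equivrel Om => Some R : withbot _).
have lE d (M : latticeType d) h r : eval h (lift r) = eval (fun i R => h i (Some R)) r :> M.
  by elim: r => //= s -> t ->.
rewrite !(eval_hom _ fh fi) => e.
(* Reflection is tested in [C] with a new zero; inequalities between values of lifted terms there
   are inequalities in [C]. *)
have ih i : lattice0_hom (omap (iota i) : withbot (equivrel Om) -> withbot C).
  exact: withbot_hom (ci.1 i).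
have le r s : eval (fun i R => F i (Some R)) r = eval (fun i R => F i (Some R)) s ->
    eval iota r <= eval iota s.
  move=> ers; have := Fle _ (withbot C) _ ih (lift r) (lift s).
  rewrite !lE ers => /(_ (lexx _)).
  have E t : eval (fun i R => omap (iota i) (Some R) : withbot C) t = Some (eval iota t).
    by apply: esym; apply: (@eval_hom _ _ _ _ C (withbot C) Some iota).
  by rewrite !E.
by apply/eqP; rewrite eq_le !le.
Qed.

Theorem theorem6p6 (Omega : Type) (Hinf : infinite_set [set: Omega]) :
  (* (1) *)
  (forall dC (C : bLatticeType dC) (iota : classical_sets.set Omega -> equivrel Omega -> C),
      lattice0_coproduct iota ->
      exists f : C -> equivrel Omega, lattice0_embedding f) /\
  (* (2) *)
  (forall dC (C : latticeType dC) (iota : classical_sets.set Omega -> equivrel Omega -> C),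
      lattice_coproduct iota ->
      exists f : C -> equivrel Omega, lattice_embedding f) /\
  (* (3) *)
  (forall dC (C : tLatticeType dC)
          (iota : classical_sets.set Omega -> Order.dual (equivrel Omega) -> C),
      lattice1_coproduct iota ->
      exists f : C -> Order.dual (equivrel Omega), lattice1_embedding f) /\
  (* (4) *)
  (forall dC (C : latticeType dC)
          (iota : classical_sets.set Omega -> Order.dual (equivrel Omega) -> C),
      lattice_coproduct iota ->
      exists f : C -> Order.dual (equivrel Omega), lattice_embedding f).
Proof.
split; first exact: coproduct0_embed.
split; first exact: coproduct_embed.
split=> dC C iota [hi univ].
(* The dual of [C] is a coproduct with zero of the undualized factors: the universal property is
   transported by dualizing the target [M]. *)
- have ci : lattice0_coproduct (L := equivrel Omega) (C := Order.dual C) iota.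
    split=> [i|dM M f fh].
      by split=> [x y|]; [have [-> ->] := (hi i).1 x y|exact: (hi i).2].
    have fh' i : lattice1_hom (M := Order.dual M) (f i : Order.dual (equivrel Omega) -> _).
      by split=> [x y|]; [have [] := (fh i).1 x y|exact: (fh i).2].
    have [h [[hh hi'] hu]] := univ _ (Order.dual M) _ fh'.
    exists h; split.
      by split=> //; split=> [x y|]; [have [] := hh.1 x y|exact: hh.2].
    move=> g [gh gi]; apply: hu; split=> //.
    by split=> [x y|]; [have [] := gh.1 x y|exact: gh.2].
  have [f [[fh f0] fi]] := coproduct0_embed Hinf ci.
  by exists f; split=> //; split=> // x y; have [] := fh x y.
- have ci : lattice_coproduct (L := equivrel Omega) (C := Order.dual C) iota.
    split=> [i x y|dM M f fh]; first by have [-> ->] := hi i x y.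
    have fh' i : lattice_hom (M := Order.dual M) (f i : Order.dual (equivrel Omega) -> _).
      by move=> x y; have [] := fh i x y.
    have [h [[hh hi'] hu]] := univ _ (Order.dual M) _ fh'.
    exists h; split; first by split=> // x y; have [] := hh x y.
    by move=> g [gh gi]; apply: hu; split=> // x y; have [] := gh x y.
  have [f [fh fi]] := coproduct_embed Hinf ci.
  by exists f; split=> // x y; have [] := fh x y.
Qed.
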